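(* Let $n\ge 3$. A bijective real-linear map $T\colon M_n(\mathbb F)\to M_n(\mathbb F)$ satisfies $$\|T(A)T(B)\|=\|T(A)\|\,\|T(B)\|\quad\text{for all } A,B\in M_n(\mathbb F) \text{ with } \|AB\|=\|A\|\,\|B\|$$ if and only if there exist a nonzero $\gamma\in\mathbb F$ and $U\in\mathcal U_n(\mathbb F)$ such that either $T(A)=\gamma UAU^*$ for all $A$, or $T(A)=\gamma U\overline{A}U^*$ for all $A$.
   Context: $\mathbb F$ denotes either $\mathbb C$ or $\mathbb R$, $M_n(\mathbb F)$ the $n\times n$ matrices over $\mathbb F$, $A^*$ the conjugate transpose (transpose if $\mathbb F=\mathbb R$), $\overline{A}$ the entrywise complex conjugate, and $\mathcal U_n(\mathbb F)=\{A: A^*A=I_n\}$. $\|\cdot\|$ is the spectral norm (operator norm induced by the Euclidean norm, equal to the largest singular value). *)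

(* Defs.v *)
(* matrices from mathcomp, real numbers as an abstract
   [R : realType] (mathcomp-analysis, for [sup]), complex numbers as [R[i]]
   (mathcomp-real-closed). *)
From HB Require Import structures.
From mathcomp Require Import all_boot all_order all_algebra.
From mathcomp Require Import boolp classical_sets reals.
From mathcomp Require Export complex.
Set Implicit Arguments. Unset Strict Implicit. Unset Printing Implicit Defensive.
Import Order.TTheory GRing.Theory Num.Theory.
Local Open Scope ring_scope.
Local Open Scope classical_set_scope.

Section Generic.
(* F is the scalar field (R or R[i]); [emb] embeds the reals into F,
   [cj] is complex conjugation on F (identity when F = R), and
   [nrm2 x] is the squared modulus |x|^2 of a scalar, as a real number. *)
Variables (R : realType) (F : comNzRingType).
Variables (emb : R -> F) (cj : F -> F) (nrm2 : F -> R).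

(* Euclidean norm of a column vector *)
Definition vnorm n (x : 'cV[F]_n) : R := Num.sqrt (\sum_(i < n) nrm2 (x i 0)).

(* spectral norm = operator norm induced by the Euclidean norm *)
Definition opnorm n (A : 'M[F]_n) : R :=
  sup [set r : R | exists x : 'cV[F]_n, vnorm x = 1 /\ r = vnorm (A *m x)].

(* entrywise conjugate and conjugate transpose *)
Definition mconj n (A : 'M[F]_n) : 'M[F]_n := map_mx cj A.
Definition adj n (A : 'M[F]_n) : 'M[F]_n := (map_mx cj A)^T.

Definition unitary n (U : 'M[F]_n) : Prop := adj U *m U = 1%:M.

Definition real_linear n (T : 'M[F]_n -> 'M[F]_n) : Prop :=
  forall (a : R) (A B : 'M[F]_n), T (emb a *: A + B) = emb a *: T A + T B.

Definition preserves_norm_mult n (T : 'M[F]_n -> 'M[F]_n) : Prop :=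
  forall A B : 'M[F]_n, opnorm (A *m B) = opnorm A * opnorm B ->
    opnorm (T A *m T B) = opnorm (T A) * opnorm (T B).

Definition main_stmt (n : nat) : Prop :=
  forall T : 'M[F]_n -> 'M[F]_n, real_linear T -> bijective T ->
    (preserves_norm_mult T <->
     exists (gamma : F) (U : 'M[F]_n),
       [/\ gamma != 0, unitary U &
        (forall A, T A = gamma *: (U *m A *m adj U)) \/
        (forall A, T A = gamma *: (U *m mconj A *m adj U))]).
End Generic.

(* The two instances: F = R and F = C = R[i]. *)
Definition main_stmt_real (R : realType) (n : nat) : Prop :=
  @main_stmt R R id id (fun a : R => a ^+ 2) n.

Definition main_stmt_complex (R : realType) (n : nat) : Prop :=
  @main_stmt R R[i] (fun a : R => (a%:C)%C) (fun z : R[i] => (z^*)%C)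
    (fun z : R[i] => complex.Re z ^+ 2 + complex.Im z ^+ 2) n.

(* Main.v *)
(* The norm of A B is the product of the norms exactly when some direction y is
   one in which both A and B^* attain their norms. Testing against rank-one
   matrices, which are images because T is onto, T maps unitaries to multiples
   of unitaries, and for every y' there is a y such that T(B)^* attains its norm
   at y' whenever B^* does at y.

   Put k(Z) = T(Z)T(1)^* + T(1)T(Z)^*. Since T maps unitaries to multiples of
   unitaries, k(Z) is a real scalar for Z skew-Hermitian, so k is a bijection of
   the Hermitian matrices, and for z orthogonal to y the form of k(zz^* ) is
   minimal at y'. This forces k(yy^* ) = m y'y'^* + r with m > 0, and y' |-> y
   preserves orthogonality; a coordinate version of Wigner's theorem gives
   y = U s(y') with U unitary and s the identity or the conjugation.

   After composing T with A |-> U s(A) U^*, one may take y = y', for T and then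
   also for A |-> T(A^* )^*. Comparing the two rank-one formulas at a unitary V
   gives T(V) = g V for a scalar g, and a real-linear map having all unitaries
   as eigenvectors is scalar. *)
Require Import Defs.
From HB Require Import structures.
From mathcomp Require Import all_boot all_order all_algebra.
From mathcomp Require Import boolp classical_sets reals complex.
From mathcomp Require Import ring lra.
Set Implicit Arguments. Unset Strict Implicit. Unset Printing Implicit Defensive.
Import Order.TTheory GRing.Theory Num.Theory.
Local Open Scope ring_scope.

(** The map k is the derivative at 1 of U |-> T(U)T(U)^*, and the skew-Hermitian matrices are the
    directions tangent to the unitary group: this is why k is scalar on them. It also sets the main
    obstacle. Information about k holds only modulo real scalar matrices, so every rank-one formula
    carries an unknown scalar; a vector orthogonal to two given ones, or a third index, removes it,
    and this is where n >= 3 enters. Preservation is assumed in one direction only. Each y' receives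
    some y, but neither uniqueness of y nor that every y occurs is known beforehand. The
    correspondence is therefore a relation, and Wigner's theorem is applied to an inverse of k.
    Comparisons of real dimensions are replaced by the injectivity of surjective real-linear
    endomorphisms. The comparison at V uses A |-> T(AV), which need not preserve norm products;
    hence k is studied for maps known only to send unitaries to multiples of unitaries. Norms are
    kept squared and vectors mostly unnormalized, since attaining the norm is a property of a
    line. *)

(* What the proof uses of the scalar field, so that F = R and F = R[i] are
   treated at once. [fin_dim] is finite dimensionality over R, in the form that
   surjective real-linear endomorphisms are injective; [attained] is the
   compactness of the unit sphere. *)
Record scalars (R : realType) (F : fieldType) := Scalars {
  emb : {rmorphism R -> F};
  cj : {rmorphism F -> F};
  re : F -> R;
  nrm2 : F -> R;
  cjK : involutive cj;
  cj_emb : forall a, cj (emb a) = emb a;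
  addcj : forall x, x + cj x = emb (re x *+ 2);
  mulcj : forall x, x * cj x = emb (nrm2 x);
  nrm2_ge0 : forall x, 0 <= nrm2 x;
  fin_dim : forall m p (g : 'M[F]_(m, p) -> 'M[F]_(m, p)),
    (forall a A B, g (emb a *: A + B) = emb a *: g A + g B) ->
    (forall B, exists A, g A = B) -> forall A, g A = 0 -> A = 0;
  attained : forall n (A : 'M[F]_n), (0 < n)%N ->
    exists2 x : 'cV[F]_n, \sum_i nrm2 (x i 0) = 1 &
      forall y : 'cV[F]_n, \sum_i nrm2 (y i 0) = 1 ->
        \sum_i nrm2 ((A *m y) i 0) <= \sum_i nrm2 ((A *m x) i 0);
  cj_cases : (forall x, cj x = x) \/
    exists i, [/\ i * i = -1, cj i = - i &
                  forall x, exists a b, x = emb a + emb b * i] }.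

(** * Scalars: conjugation, real part, squared modulus *)

Section Scalars.
Variables (R : realType) (F : fieldType) (S : scalars R F).
Local Notation emb := (emb S).
Local Notation cj := (cj S).
Local Notation re := (re S).
Local Notation nrm2 := (nrm2 S).

Lemma emb_inj : injective emb. Proof. exact: fmorph_inj. Qed.
Lemma emb_eq0 a : (emb a == 0) = (a == 0). Proof. exact: fmorph_eq0. Qed.
Lemma cj_eq0 a : (cj a == 0) = (a == 0). Proof. exact: fmorph_eq0. Qed.

(** [re] is specified only through x + cj x, which is twice the real part, so its basic rules are
    proved after doubling. *)
Lemma dbl_inj (a b : R) : emb (a *+ 2) = emb (b *+ 2) -> a = b.
Proof. by move/emb_inj/eqP; rewrite eqr_pMn2r // => /eqP. Qed.
Lemma reD x y : re (x + y) = re x + re y.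
Proof. by apply: dbl_inj; rewrite mulrnDl [RHS]rmorphD /= -!addcj rmorphD /=; ring. Qed.
Lemma re_embM a x : re (emb a * x) = a * re x.
Proof.
by apply: dbl_inj; rewrite -mulrnAr [RHS]rmorphM /= -!addcj rmorphM cj_emb mulrDr.
Qed.
Lemma re_emb a : re (emb a) = a.
Proof. by apply: dbl_inj; rewrite -addcj cj_emb mulr2n [RHS]rmorphD. Qed.
Lemma re_cj x : re (cj x) = re x.
Proof. by apply: dbl_inj; rewrite -!addcj cjK addrC. Qed.
Lemma re0 : re 0 = 0. Proof. by rewrite -(rmorph0 emb) re_emb. Qed.
Lemma reN x : re (- x) = - re x.
Proof. by apply/eqP; rewrite -addr_eq0 -reD addNr re0. Qed.
Lemma emb_nat k : emb k%:R = k%:R. Proof. exact: rmorph_nat. Qed.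
Lemma nat_neq0 k : k.+1%:R != 0 :> F.
Proof. by rewrite -emb_nat emb_eq0 pnatr_eq0. Qed.
Lemma cj_real x : cj x = x -> x = emb (re x).
Proof.
move=> h; apply: (mulIf (nat_neq0 1)).
by rewrite !mulr_natr mulr2n -[X in _ + X = _]h addcj rmorphMn.
Qed.
Lemma nrm2_eq0 x : (nrm2 x == 0) = (x == 0).
Proof. by rewrite -emb_eq0 -mulcj mulf_eq0 cj_eq0 orbb. Qed.
Lemma nrm2M x y : nrm2 (x * y) = nrm2 x * nrm2 y.
Proof. by apply: emb_inj; rewrite rmorphM /= -!mulcj rmorphM; ring. Qed.
Lemma nrm2_emb a : nrm2 (emb a) = a ^+ 2.
Proof. by apply: emb_inj; rewrite -mulcj cj_emb rmorphXn expr2. Qed.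
Lemma nrm2_cj x : nrm2 (cj x) = nrm2 x.
Proof. by apply: emb_inj; rewrite -!mulcj cjK mulrC. Qed.
Lemma nrm2_0 : nrm2 0 = 0. Proof. by apply/eqP; rewrite nrm2_eq0. Qed.
Lemma nrm2D x y : nrm2 (x + y) = nrm2 x + nrm2 y + 2 * re (cj x * y).
Proof.
apply: emb_inj; rewrite 2!rmorphD -!mulcj /= mulr_natl -addcj !rmorphD rmorphM /= cjK.
by ring.
Qed.

(** Rectangular form of [adj], convertible with it on square matrices; inner products become the 1 x
    1 products [ct x *m y]. *)
Definition ct m p (A : 'M[F]_(m, p)) : 'M[F]_(p, m) := (map_mx cj A)^T.

Lemma ctE m p (A : 'M[F]_(m, p)) i j : ct A i j = cj (A j i).
Proof. by rewrite !mxE. Qed.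
Lemma ctK m p : cancel (@ct m p) (@ct p m).
Proof. by move=> A; apply/matrixP => i j; rewrite !mxE cjK. Qed.
Lemma ctM m p q (A : 'M[F]_(m, p)) (B : 'M_(p, q)) : ct (A *m B) = ct B *m ct A.
Proof. by rewrite /ct map_mxM trmx_mul. Qed.
Lemma ctD m p (A B : 'M[F]_(m, p)) : ct (A + B) = ct A + ct B.
Proof. by rewrite /ct map_mxD linearD. Qed.
Lemma ctN m p (A : 'M[F]_(m, p)) : ct (- A) = - ct A.
Proof. by rewrite /ct map_mxN linearN. Qed.
Lemma ctB m p (A B : 'M[F]_(m, p)) : ct (A - B) = ct A - ct B.
Proof. by rewrite ctD ctN. Qed.
Lemma ctZ m p a (A : 'M[F]_(m, p)) : ct (a *: A) = cj a *: ct A.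
Proof. by rewrite /ct map_mxZ linearZ. Qed.
Lemma ct0 m p : ct (0 : 'M[F]_(m, p)) = 0.
Proof. by rewrite /ct map_mx0 linear0. Qed.
Lemma ct_scalar m a : ct (a%:M : 'M[F]_m) = (cj a)%:M.
Proof. by rewrite /ct map_scalar_mx tr_scalar_mx. Qed.
Lemma ct1 m : ct (1%:M : 'M[F]_m) = 1%:M.
Proof. by rewrite ct_scalar rmorph1. Qed.
Lemma ct_sum m p I (r : seq I) P (f : I -> 'M[F]_(m, p)) :
  ct (\sum_(i <- r | P i) f i) = \sum_(i <- r | P i) ct (f i).
Proof. exact: (big_morph _ (@ctD m p) (@ct0 m p)). Qed.
Lemma ct_delta m p i j : ct (delta_mx i j : 'M[F]_(m, p)) = delta_mx j i.
Proof.
by apply/matrixP => k l; rewrite !mxE andbC; case: (_ && _); rewrite ?rmorph1 ?rmorph0.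
Qed.

Definition dot n (x y : 'cV[F]_n) : F := (ct x *m y) 0 0.
Definition rd n (x y : 'cV[F]_n) : R := re (dot x y).
Definition nq n (x : 'cV[F]_n) : R := \sum_i nrm2 (x i 0).

(** * Inner product, rank-one matrices, Cauchy-Schwarz *)

Section Vectors.
Variable n : nat.
Implicit Types (x y z : 'cV[F]_n) (A B : 'M[F]_n).

Lemma dotE x y : dot x y = \sum_i cj (x i 0) * y i 0.
Proof. by rewrite /dot mxE; apply: eq_bigr => i _; rewrite ctE. Qed.
Lemma dotDr x y z : dot x (y + z) = dot x y + dot x z.
Proof. by rewrite /dot mulmxDr mxE. Qed.
Lemma dotDl x y z : dot (x + y) z = dot x z + dot y z.
Proof. by rewrite /dot ctD mulmxDl mxE. Qed.
Lemma dotZr a x y : dot x (a *: y) = a * dot x y.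
Proof. by rewrite /dot -scalemxAr mxE. Qed.
Lemma dotZl a x y : dot (a *: x) y = cj a * dot x y.
Proof. by rewrite /dot ctZ -scalemxAl mxE. Qed.
Lemma dotNr x y : dot x (- y) = - dot x y.
Proof. by rewrite /dot mulmxN mxE. Qed.
Lemma dotNl x y : dot (- x) y = - dot x y.
Proof. by rewrite /dot ctN mulNmx mxE. Qed.
Lemma dotBr x y z : dot x (y - z) = dot x y - dot x z.
Proof. by rewrite dotDr dotNr. Qed.
Lemma dot0r x : dot x 0 = 0. Proof. by rewrite /dot mulmx0 mxE. Qed.
Lemma dot0l x : dot 0 x = 0. Proof. by rewrite /dot ct0 mul0mx mxE. Qed.
Lemma dotC x y : dot y x = cj (dot x y).
Proof.
rewrite !dotE rmorph_sum; apply: eq_bigr => i _.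
by rewrite rmorphM /= cjK mulrC.
Qed.
Lemma dotxx x : dot x x = emb (nq x).
Proof.
rewrite dotE /nq rmorph_sum; apply: eq_bigr => i _.
by rewrite mulrC mulcj.
Qed.
Lemma ct_mul_dot x y : ct x *m y = (dot x y)%:M.
Proof. by rewrite [LHS]mx11_scalar. Qed.
Lemma dot_mulr x A y : dot x (A *m y) = dot (ct A *m x) y.
Proof. by rewrite /dot ctM ctK mulmxA. Qed.
Lemma dot_mull x A y : dot (A *m x) y = dot x (ct A *m y).
Proof. by rewrite dot_mulr ctK. Qed.

Definition oproj x y : 'M[F]_n := x *m ct y.

Lemma oprojE x y z : oproj x y *m z = dot y z *: x.
Proof. by rewrite /oproj -mulmxA ct_mul_dot mul_mx_scalar. Qed.
Lemma ct_oproj x y : ct (oproj x y) = oproj y x.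
Proof. by rewrite /oproj ctM ctK. Qed.
Lemma oproj_mull A x y : A *m oproj x y = oproj (A *m x) y.
Proof. by rewrite /oproj mulmxA. Qed.
Lemma oproj_mulr A x y : oproj x y *m A = oproj x (ct A *m y).
Proof. by rewrite /oproj ctM ctK mulmxA. Qed.
Lemma oprojDl x y z : oproj (x + y) z = oproj x z + oproj y z.
Proof. by rewrite /oproj mulmxDl. Qed.
Lemma oprojDr x y z : oproj z (x + y) = oproj z x + oproj z y.
Proof. by rewrite /oproj ctD mulmxDr. Qed.
Lemma oprojZl a x z : oproj (a *: x) z = a *: oproj x z.
Proof. by rewrite /oproj scalemxAl. Qed.
Lemma oprojZr a x z : oproj x (a *: z) = cj a *: oproj x z.
Proof. by rewrite /oproj ctZ scalemxAr. Qed.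
Lemma oproj_entry x y i j : oproj x y i j = x i 0 * cj (y j 0).
Proof. by rewrite /oproj mxE big_ord1 ctE. Qed.

Lemma rdxx x : rd x x = nq x. Proof. by rewrite /rd dotxx re_emb. Qed.
Lemma rdC x y : rd x y = rd y x. Proof. by rewrite /rd dotC re_cj. Qed.
Lemma rdDr x y z : rd x (y + z) = rd x y + rd x z.
Proof. by rewrite /rd dotDr reD. Qed.
Lemma rdDl x y z : rd (x + y) z = rd x z + rd y z.
Proof. by rewrite /rd dotDl reD. Qed.
Lemma rdZr a x y : rd x (emb a *: y) = a * rd x y.
Proof. by rewrite /rd dotZr re_embM. Qed.
Lemma rdZl a x y : rd (emb a *: x) y = a * rd x y.
Proof. by rewrite rdC rdZr rdC. Qed.
Lemma rdNr x y : rd x (- y) = - rd x y. Proof. by rewrite /rd dotNr reN. Qed.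
Lemma rdNl x y : rd (- x) y = - rd x y. Proof. by rewrite /rd dotNl reN. Qed.
Lemma rdBr x y z : rd x (y - z) = rd x y - rd x z.
Proof. by rewrite rdDr rdNr. Qed.
Lemma rdBl x y z : rd (x - y) z = rd x z - rd y z.
Proof. by rewrite rdDl rdNl. Qed.
Lemma rd_mulr x A y : rd x (A *m y) = rd (ct A *m x) y.
Proof. by rewrite /rd dot_mulr. Qed.
Lemma rd0r x : rd x 0 = 0. Proof. by rewrite /rd dot0r re0. Qed.

Lemma nq_ge0 x : 0 <= nq x.
Proof. by apply: sumr_ge0 => i _; apply: nrm2_ge0. Qed.
Lemma nq_eq0 x : (nq x == 0) = (x == 0).
Proof.
apply/eqP/eqP => [h|->]; last first.
  by rewrite -rdxx rd0r.
apply/colP => i; apply/eqP; rewrite mxE -nrm2_eq0.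
move/eqP: h; rewrite psumr_eq0; last by move=> j _; apply: nrm2_ge0.
by move/allP/(_ i); rewrite mem_index_enum; apply.
Qed.
Lemma nq_gt0 x : (0 < nq x) = (x != 0).
Proof. by rewrite lt_def nq_eq0 nq_ge0 andbT. Qed.
Lemma nqZ a x : nq (a *: x) = nrm2 a * nq x.
Proof. by rewrite /nq mulr_sumr; apply: eq_bigr => i _; rewrite mxE nrm2M. Qed.
Lemma nq0 : nq (0 : 'cV_n) = 0. Proof. by apply/eqP; rewrite nq_eq0. Qed.
Lemma nqD x y : nq (x + y) = nq x + nq y + 2 * rd x y.
Proof. by rewrite -!rdxx rdDr !rdDl (rdC y x); ring. Qed.
Lemma nqB x y : nq (x - y) = nq x + nq y - 2 * rd x y.
Proof. by rewrite -!rdxx rdBr !rdBl (rdC y x); ring. Qed.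
Lemma dotxx_eq0 x : (dot x x == 0) = (x == 0).
Proof. by rewrite dotxx emb_eq0 nq_eq0. Qed.

Lemma rd_ext x : (forall y, rd y x = 0) -> x = 0.
Proof. by move=> /(_ x); rewrite rdxx => /eqP; rewrite nq_eq0 => /eqP. Qed.

Lemma unit_scale x : x != 0 -> exists2 a : R, 0 < a & nq (emb a *: x) = 1.
Proof.
move=> x0; exists (Num.sqrt (nq x))^-1.
  by rewrite invr_gt0 sqrtr_gt0 nq_gt0.
by rewrite nqZ nrm2_emb exprVn sqr_sqrtr ?nq_ge0 // mulVf // gt_eqF // nq_gt0.
Qed.

Lemma cauchy x y : nrm2 (dot x y) <= nq x * nq y.
Proof.
have [->|x0] := eqVneq x 0; first by rewrite dot0l nrm2_0 nq0 mul0r.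
(* This vector is |x|^2 times the component of y orthogonal to x, which avoids a division. *)
have h := nq_ge0 (emb (nq x) *: y - dot x y *: x).
rewrite nqB !nqZ nrm2_emb /rd dotZr dotZl (dotC x y) cj_emb in h.
rewrite [emb _ * _]mulrC mulrA mulcj -rmorphM re_emb in h.
have p := nq_gt0 x; rewrite x0 in p.
rewrite -(ler_pM2l p); nra.
Qed.

Lemma cauchy_eq x y : x != 0 -> nrm2 (dot x y) = nq x * nq y ->
  exists c, y = c *: x.
Proof.
move=> x0 e; exists (dot x y / emb (nq x)).
have h : nq (emb (nq x) *: y - dot x y *: x) = 0.
  rewrite nqB !nqZ nrm2_emb /rd dotZr dotZl (dotC x y) cj_emb.
  rewrite [emb _ * _]mulrC mulrA mulcj -rmorphM re_emb e; ring.
move/eqP: h; rewrite nq_eq0 subr_eq0 => /eqP h.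
have nx : emb (nq x) != 0 by rewrite emb_eq0 nq_eq0.
by apply: (scalerI nx); rewrite h scalerA mulrC divfK.
Qed.

End Vectors.

(** The n x 2 matrix with columns conj x and conj y has rank at most 2 < n, hence a nonzero left
    kernel. *)
Lemma orth_pair n (x y : 'cV[F]_n) : (2 < n)%N ->
  exists2 w : 'cV[F]_n, w != 0 & dot x w = 0 /\ dot y w = 0.
Proof.
move=> n3; pose M : 'M[F]_(n, 1 + 1) := row_mx (map_mx cj x) (map_mx cj y).
have : kermx M != 0.
  rewrite kermx_eq0 /row_free neq_ltn; apply/orP; left.
  exact: leq_ltn_trans (rank_leq_col M) n3.
case/rowV0Pn => v vk v0; move/sub_kermxP: vk => vM.
exists v^T; first by apply: contra v0 => /eqP h; rewrite -[v]trmxK h trmx0.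
rewrite /M mul_mx_row in vM.
have [h1 h2] : v *m map_mx cj x = 0 /\ v *m map_mx cj y = 0.
  by apply: (@eq_row_mx _ _ _ _ _ _ 0 0); rewrite vM row_mx0.
by split; rewrite /dot /ct -trmx_mul ?h1 ?h2 !mxE.
Qed.

(** * Real scalar matrices; generators of the Hermitian and skew-Hermitian matrices *)

Section Matrices.
Variable n : nat.
Implicit Types (x y z : 'cV[F]_n) (A B H K : 'M[F]_n).
Local Notation e_ i := (delta_mx i 0 : 'cV[F]_n).

(** Real scalar matrices are the indeterminacy of the argument: formulas are stated as [isR] of a
    difference. *)
Definition isR A := exists r, A = (emb r)%:M.

Lemma isR0 : isR 0. Proof. by exists 0; rewrite rmorph0 raddf0. Qed.
Lemma isR1 r : isR (emb r)%:M. Proof. by exists r. Qed.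
Lemma isRD A B : isR A -> isR B -> isR (A + B).
Proof. by case=> a -> [b ->]; exists (a + b); rewrite rmorphD raddfD. Qed.
Lemma isRZ a A : isR A -> isR (emb a *: A).
Proof. by case=> b ->; exists (a * b); rewrite rmorphM scale_scalar_mx. Qed.
Lemma isRN A : isR A -> isR (- A).
Proof. by case=> b ->; exists (- b); rewrite rmorphN raddfN. Qed.
Lemma isRB A B : isR A -> isR B -> isR (A - B).
Proof. by move=> a b; apply: isRD => //; apply: isRN. Qed.
Lemma isR_sum I (r : seq I) (P : pred I) (f : I -> 'M[F]_n) :
  (forall i, P i -> isR (f i)) -> isR (\sum_(i <- r | P i) f i).
Proof. by move=> h; elim/big_ind: _ => //; [exact: isR0 | exact: isRD]. Qed.

(** These are X + X^* and X - X^* for X = a E_ij, also when i = j. *)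
Definition h2 i j a : 'M[F]_n := a *: delta_mx i j + cj a *: delta_mx j i.
Definition s2 i j a : 'M[F]_n := a *: delta_mx i j - cj a *: delta_mx j i.

Lemma add_ct A : A + ct A = \sum_i \sum_j h2 i j (A i j).
Proof.
rewrite {2}[A]matrix_sum_delta {1}[A]matrix_sum_delta ct_sum -big_split.
apply: eq_bigr => i _; rewrite ct_sum -big_split; apply: eq_bigr => j _.
by rewrite ctZ ct_delta.
Qed.
Lemma sub_ct A : A - ct A = \sum_i \sum_j s2 i j (A i j).
Proof.
rewrite {2}[A]matrix_sum_delta {1}[A]matrix_sum_delta ct_sum -sumrB.
apply: eq_bigr => i _; rewrite ct_sum -sumrB; apply: eq_bigr => j _.
by rewrite ctZ ct_delta.
Qed.

Lemma half_emb : emb 2^-1 * 2%:R = 1 :> F.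
Proof. by rewrite -emb_nat -rmorphM mulVf ?rmorph1 // pnatr_eq0. Qed.
Lemma half_scale m p (A : 'M[F]_(m, p)) : emb 2^-1 *: (A + A) = A.
Proof. by rewrite -mulr2n -scaler_nat scalerA half_emb scale1r. Qed.

Lemma oproj_delta i j : oproj (e_ i) (e_ j) = delta_mx i j.
Proof. by rewrite /oproj ct_delta mul_delta_mx. Qed.

(** Polarization: it makes real combinations of the matrices zz^* exhaust the Hermitian matrices. *)
Lemma h2_polar i j a : h2 i j a = emb 2^-1 *:
  (oproj (a *: e_ i + e_ j) (a *: e_ i + e_ j) -
   oproj (a *: e_ i - e_ j) (a *: e_ i - e_ j)).
Proof.
rewrite -[LHS]half_scale; congr (_ *: _).
have -> : a *: e_ i - e_ j = a *: e_ i + (-1) *: e_ j by rewrite scaleN1r.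
rewrite !(oprojDl, oprojDr, oprojZl, oprojZr) !oproj_delta /h2 rmorphN1.
by apply/matrixP => k l; rewrite !mxE; ring.
Qed.

Section Induction.
Variable P : 'M[F]_n -> Prop.
Hypotheses (PD : forall A B, P A -> P B -> P (A + B))
           (PZ : forall a A, P A -> P (emb a *: A)).

Lemma P_sum A I (r : seq I) (Q : pred I) (f : I -> 'M[F]_n) : P A ->
  (forall i, Q i -> P (f i)) -> P (\sum_(i <- r | Q i) f i).
Proof.
move=> PA h; elim/big_ind: _ => //.
by move: (PZ 0 PA); rewrite rmorph0 scale0r.
Qed.

Lemma herm_ind : (forall z, P (oproj z z)) -> forall H, ct H = H -> P H.
Proof.
move=> Pz H hH; rewrite -[H]half_scale -{2}hH add_ct; apply: PZ.
apply: (P_sum _ (Pz 0)) => i _; apply: (P_sum _ (Pz 0)) => j _; rewrite h2_polar; apply: PZ.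
by apply: PD => //; rewrite -scaleN1r -(rmorphN1 emb); apply: PZ.
Qed.

(** Q is an orthogonal projection and K a complex structure on its range, extended by 0. *)
Definition skewp K Q :=
  [/\ ct K = - K, ct Q = Q, K *m K = - Q, Q *m K = K & K *m Q = K].

Lemma skewp0 : skewp 0 0.
Proof. by split; rewrite ?ct0 ?oppr0 ?mulmx0. Qed.

Lemma sqrt_unit (a : F) : a != 0 ->
  exists r b, a = emb r * b /\ b * cj b = 1.
Proof.
move=> a0; have r0 : 0 < nrm2 a by rewrite lt_def nrm2_ge0 nrm2_eq0 a0.
have s0 : Num.sqrt (nrm2 a) != 0 by rewrite gt_eqF // sqrtr_gt0.
exists (Num.sqrt (nrm2 a)), (a / emb (Num.sqrt (nrm2 a))); split.
  by rewrite mulrC divfK // emb_eq0.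
rewrite mulcj nrm2M -fmorphV nrm2_emb exprVn sqr_sqrtr ?ltW // mulfV ?rmorph1 //.
by rewrite gt_eqF.
Qed.

(* The matrices K below are the generators of plane rotations (and, over the
   complex numbers, of phase changes of one coordinate), see [unitary_rot]. *)
Lemma s2_skewp i j a : exists r K Q, [/\ skewp K Q, s2 i j a = emb r *: K &
  forall l, l != i -> l != j -> K *m e_ l = 0].
Proof.
have key : forall b, b * cj b = 1 -> i != j ->
   skewp (s2 i j b) (delta_mx i i + delta_mx j j).
  move=> b b1 ij; have ji : j != i by rewrite eq_sym.
  rewrite /skewp /s2; split.
  - by rewrite ctB !ctZ !ct_delta cjK opprB.
  - by rewrite ctD !ct_delta.
  - rewrite mulmxBl !mulmxBr -!scalemxAl -!scalemxAr !mul_delta_mx_cond.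
    rewrite !eqxx !(negbTE ij, negbTE ji) !mulr0n !mulr1n !scaler0 !scalerA.
    by rewrite b1 mulrC b1 !scale1r subr0 sub0r opprD addrC.
  - rewrite mulmxBr !mulmxDl -!scalemxAr !mul_delta_mx_cond.
    by rewrite !eqxx !(negbTE ij, negbTE ji) !mulr0n !mulr1n !scaler0 addr0 add0r.
  - rewrite mulmxBl !mulmxDr -!scalemxAl !mul_delta_mx_cond.
    by rewrite !eqxx !(negbTE ij, negbTE ji) !mulr0n !mulr1n !scaler0 addr0 add0r.
have [ij|ij] := eqVneq i j.
  (* On the diagonal the generator is (a - cj a) E_jj, purely imaginary; when nonzero, its
     unimodular part b has square -1. *)
  subst j; have [b0|b0] := eqVneq (a - cj a) 0.
    exists 0, 0, 0; split; first exact: skewp0.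
      by rewrite scaler0 /s2 -scalerBl b0 scale0r.
    by move=> *; rewrite mul0mx.
  have [r [b [e b1]]] := sqrt_unit b0.
  have r0 : emb r != 0 by apply: contra b0 => /eqP h; rewrite e h mul0r.
  have cb : cj b = - b.
    apply: (mulfI r0); rewrite mulrN -e -{1}(cj_emb S r) -rmorphM -e rmorphB /= cjK.
    by rewrite opprB.
  have bb : b * b = - 1 by rewrite -b1 cb mulrN opprK.
  exists r, (b *: delta_mx i i), (delta_mx i i); split; first split.
  - by rewrite ctZ ct_delta cb scaleNr.
  - by rewrite ct_delta.
  - by rewrite -scalemxAl -scalemxAr mul_delta_mx scalerA bb scaleN1r.
  - by rewrite -scalemxAr mul_delta_mx.
  - by rewrite -scalemxAl mul_delta_mx.
  - by rewrite /s2 -scalerBl e scalerA.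
  - move=> l li _; rewrite -scalemxAl mul_delta_mx_cond eq_sym (negbTE li).
    by rewrite mulr0n scaler0.
have [->|a0] := eqVneq a 0.
  exists 0, 0, 0; split; first exact: skewp0.
    by rewrite scaler0 /s2 rmorph0 !scale0r subr0.
  by move=> *; rewrite mul0mx.
have [r [b [e b1]]] := sqrt_unit a0.
exists r, (s2 i j b), (delta_mx i i + delta_mx j j); split; first exact: key.
  by rewrite /s2 e rmorphM cj_emb scalerBr !scalerA.
move=> l li lj; rewrite /s2 mulmxBl -!scalemxAl !mul_delta_mx_cond.
by rewrite ![_ == l]eq_sym (negbTE li) (negbTE lj) !mulr0n !scaler0 subr0.
Qed.

(** The support condition leaves a third basis vector killed by K when n >= 3, which
    [unitary_eigen_scalar] exploits. *)
Lemma skew_ind : P 0 ->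
  (forall K Q, skewp K Q ->
     (exists i j, forall l, l != i -> l != j -> K *m e_ l = 0) -> P K) ->
  forall K, ct K = - K -> P K.
Proof.
move=> P0 Pz K hK; rewrite -[K]half_scale -{2}[K]opprK -hK sub_ct; apply: PZ.
apply: (P_sum _ P0) => i _; apply: (P_sum _ P0) => j _.
have [r [B [Q [hB -> hw]]]] := s2_skewp i j (K i j).
by apply: PZ; apply: Pz hB _; exists i, j.
Qed.
End Induction.
End Matrices.

(** * Spectral norm and the directions in which it is attained *)

Section OperatorNorm.
Variable n : nat.
Hypothesis n_gt0 : (0 < n)%N.
Implicit Types (x y z : 'cV[F]_n) (A B H K : 'M[F]_n).

(* [isM A y]: A attains its norm in the direction y; [isL A y]: so does its
   adjoint. Both hold trivially at y = 0. *)
Definition isM A y := forall x, nq (A *m x) * nq y <= nq (A *m y) * nq x.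
Definition isL A y := isM (ct A) y.
Definition N2 A := opnorm nrm2 A ^+ 2.

Lemma re_sqr (a : F) : re a ^+ 2 <= nrm2 a.
Proof.
have := nrm2_ge0 S (emb (- re a) + a).
by rewrite nrm2D nrm2_emb cj_emb re_embM; lra.
Qed.

Lemma rd_cauchy x y : rd x y ^+ 2 <= nq x * nq y.
Proof. exact: le_trans (re_sqr _) (cauchy x y). Qed.

(** Compactness turns the supremum into a maximum; homogeneity extends maximality from the unit
    sphere to all vectors. *)
Lemma opnorm_attained A : exists2 y, nq y = 1 &
  opnorm nrm2 A = Num.sqrt (nq (A *m y)) /\ isM A y.
Proof.
have [y y1 hy] := attained S A n_gt0; exists y => //.
have hM : isM A y.
  move=> x; have [->|x0] := eqVneq x 0; first by rewrite mulmx0 !nq0 mul0r mulr0.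
  have [a a0 ha] := unit_scale x0.
  have := hy _ ha; rewrite -!/(nq _) -scalemxAr !nqZ nrm2_emb => h.
  rewrite nqZ nrm2_emb in ha; rewrite [nq y]y1 mulr1.
  have a2 : 0 < a ^+ 2 by rewrite exprn_gt0.
  by rewrite -(ler_pM2l a2) mulrCA ha mulr1.
split=> //; apply/le_anti/andP; split.
  apply: ge_sup; first by exists (vnorm nrm2 (A *m y)), y; rewrite /vnorm y1 sqrtr1.
  move=> _ [x [hx ->]]; apply: ler_wsqrtr; have := hM x.
  have x1 : nq x = 1.
    by rewrite -[nq x]sqr_sqrtr ?nq_ge0 // -/(vnorm _ _) hx expr1n.
  by rewrite [nq y]y1 x1 !mulr1.
apply: ub_le_sup; last by exists y; rewrite /vnorm y1 sqrtr1.
exists (Num.sqrt (nq (A *m y))) => _ [x [hx ->]].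
apply: ler_wsqrtr; have := hM x.
have x1 : nq x = 1.
  by rewrite -[nq x]sqr_sqrtr ?nq_ge0 // -/(vnorm _ _) hx expr1n.
by rewrite [nq y]y1 x1 !mulr1.
Qed.

Lemma opnorm_ge0 A : 0 <= opnorm nrm2 A.
Proof. by have [y _ [-> _]] := opnorm_attained A; apply: sqrtr_ge0. Qed.

Lemma N2_ge0 A : 0 <= N2 A. Proof. exact: sqr_ge0. Qed.

Lemma isM_exists A : exists2 y, y != 0 & isM A y.
Proof.
have [y y1 [_ hM]] := opnorm_attained A; exists y => //.
by rewrite -nq_eq0 y1 oner_neq0.
Qed.

Lemma isM_N2 A y : isM A y -> nq (A *m y) = N2 A * nq y.
Proof.
have [x x1 [e hx]] := opnorm_attained A.
have eN : N2 A = nq (A *m x) by rewrite /N2 e sqr_sqrtr ?nq_ge0.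
move=> hy; have := hx y; have := hy x; rewrite x1 eN => h1 h2.
by apply/eqP; rewrite eq_le; apply/andP; split; lra.
Qed.

Lemma N2_le A x : nq (A *m x) <= N2 A * nq x.
Proof.
have [y y1 [_ hM]] := opnorm_attained A.
by have := hM x; rewrite (isM_N2 hM) y1 !mulr1.
Qed.

Lemma N2_isM A y : nq (A *m y) = N2 A * nq y -> isM A y.
Proof.
move=> e x; rewrite e mulrAC; apply: ler_wpM2r; first exact: nq_ge0.
exact: N2_le.
Qed.

Lemma isM_scale A y a : a != 0 -> isM A (a *: y) -> isM A y.
Proof.
move=> a0 h x; have := h x; rewrite -scalemxAr !nqZ mulrCA -mulrA.
by rewrite ler_pM2l // lt_def nrm2_ge0 nrm2_eq0 a0.
Qed.

Lemma N2_unique A y N : y != 0 -> isM A y -> nq (A *m y) = N * nq y -> N2 A = N.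
Proof.
move=> y0 h; rewrite (isM_N2 h) => /mulIf; apply.
by rewrite nq_eq0.
Qed.

Lemma N2_mul A B : opnorm nrm2 (A *m B) = opnorm nrm2 A * opnorm nrm2 B <->
  N2 (A *m B) = N2 A * N2 B.
Proof.
rewrite /N2 -exprMn; split=> [->//|/eqP].
by rewrite eqrXn2 ?mulr_ge0 ?opnorm_ge0 // => /eqP.
Qed.

Lemma N2_oproj x y : N2 (oproj x y) = nq x * nq y.
Proof.
have nle z : nq (oproj x y *m z) <= nq x * nq y * nq z.
  rewrite oprojE nqZ mulrC -mulrA; apply: ler_wpM2l; first exact: nq_ge0.
  exact: cauchy.
have [y0|y0] := eqVneq y 0.
  have [z z0 hz] := isM_exists (oproj x y).
  by apply: (N2_unique z0 hz); rewrite y0 oprojE dot0l scale0r nq0 mulr0 mul0r.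
have e : nq (oproj x y *m y) = nq x * nq y * nq y.
  by rewrite oprojE nqZ dotxx nrm2_emb; ring.
apply: (N2_unique y0 _ e) => z; rewrite e mulrAC.
by apply: ler_wpM2r; [exact: nq_ge0 | exact: nle].
Qed.

Lemma N2_0 : N2 0 = 0.
Proof.
have -> : 0 = oproj (0 : 'cV_n) 0 by rewrite /oproj mul0mx.
by rewrite N2_oproj nq0 mul0r.
Qed.

Lemma N2_eq0 A : N2 A = 0 -> A = 0.
Proof.
move=> h; apply/matrixP => i j; have := N2_le A (delta_mx j 0).
rewrite h mul0r => h'; have : nq (A *m delta_mx j 0) == 0.
  by rewrite eq_le h' nq_ge0.
by rewrite nq_eq0 -colE => /eqP /matrixP /(_ i 0); rewrite !mxE.
Qed.

(** Cauchy-Schwarz for |A^*y|^2 = <y, AA^*y>, at a y where A^* attains its norm. *)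
Lemma N2_ct_le A : N2 (ct A) <= N2 A.
Proof.
have [y y0 h] := isM_exists (ct A).
have e := isM_N2 h; have yp : 0 < nq y by rewrite nq_gt0.
have : nq (ct A *m y) ^+ 2 <= nq y * nq (A *m (ct A *m y)).
  have := rd_cauchy y (A *m (ct A *m y)).
  by rewrite rd_mulr rdxx.
move=> h1; have h2 := N2_le A (ct A *m y).
rewrite e in h1 h2.
have [p|p] := ltP 0 (N2 (ct A)); last exact: le_trans p (N2_ge0 _).
have {h1 h2} : (N2 (ct A) * nq y) ^+ 2 <= nq y * (N2 A * (N2 (ct A) * nq y)).
  by apply: le_trans h1 _; rewrite ler_pM2l.
have -> : (N2 (ct A) * nq y) ^+ 2 = N2 (ct A) * nq y * nq y * N2 (ct A) by ring.
have -> : nq y * (N2 A * (N2 (ct A) * nq y)) = N2 (ct A) * nq y * nq y * N2 A by ring.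
by rewrite ler_pM2l; last by rewrite mulr_gt0 // mulr_gt0.
Qed.

Lemma N2_ct A : N2 (ct A) = N2 A.
Proof. by apply/le_anti; rewrite N2_ct_le -{1}[A]ctK N2_ct_le. Qed.

Lemma N2_oproj_mul A x y : N2 (oproj x y *m A) = nq x * nq (ct A *m y).
Proof. by rewrite oproj_mulr N2_oproj. Qed.

(** Maximality makes y an eigenvector of BB^*, so B sends B^*y to a multiple of y, where A attains
    its norm; AB thus reaches the product at B^*y. For rank-one A the converse is read off from
    [N2_oproj_mul]. *)
Lemma N2_mul_common A B y : y != 0 -> isM A y -> isL B y ->
  N2 (A *m B) = N2 A * N2 B.
Proof.
move=> y0 hA hB; have [B0|B0] := eqVneq (N2 B) 0.
  by rewrite B0 mulr0 (N2_eq0 B0) mulmx0 N2_0.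
have NB : 0 < N2 B by rewrite lt_def B0 N2_ge0.
have eB : nq (ct B *m y) = N2 B * nq y by rewrite (isM_N2 hB) N2_ct.
have yp : 0 < nq y by rewrite nq_gt0.
have BB : B *m (ct B *m y) = emb (N2 B) *: y.
  apply/eqP; rewrite -subr_eq0 -nq_eq0 eq_le nq_ge0 andbT.
  rewrite nqB rdZr nqZ nrm2_emb rdC rd_mulr rdxx eB.
  by have := N2_le B (ct B *m y); rewrite eB; lra.
have x0 : ct B *m y != 0 by rewrite -nq_eq0 eB mulf_neq0 // gt_eqF.
apply: (N2_unique x0) => [x|]; last first.
  by rewrite -mulmxA BB -scalemxAr nqZ nrm2_emb (isM_N2 hA) eB; ring.
rewrite -!mulmxA BB -scalemxAr nqZ nrm2_emb (isM_N2 hA) eB.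
have h : nq (A *m (B *m x)) <= N2 A * (N2 B * nq x).
  by apply: le_trans (N2_le _ _) _; rewrite ler_wpM2l ?N2_ge0 // N2_le.
have p : 0 <= N2 B * nq y by rewrite mulr_ge0 ?ltW.
by move: (ler_wpM2r p h); lra.
Qed.

End OperatorNorm.

(** * Rules for real-linear maps *)

Section RealLinear.
Variables (n : nat) (T : 'M[F]_n -> 'M[F]_n).
Hypothesis T_lin : forall a A B, T (emb a *: A + B) = emb a *: T A + T B.

Lemma rlinD A B : T (A + B) = T A + T B.
Proof. by have := T_lin 1 A B; rewrite rmorph1 !scale1r. Qed.
Lemma rlin0 : T 0 = 0.
Proof. by apply: (addrI (T 0)); rewrite -rlinD !addr0. Qed.
Lemma rlinZ a A : T (emb a *: A) = emb a *: T A.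
Proof. by have := T_lin a A 0; rewrite rlin0 !addr0. Qed.
Lemma rlinN A : T (- A) = - T A.
Proof. by apply: (addrI (T A)); rewrite -rlinD !subrr rlin0. Qed.
Lemma rlinB A B : T (A - B) = T A - T B.
Proof. by rewrite rlinD rlinN. Qed.
Lemma rlin_sum I (r : seq I) P (f : I -> 'M[F]_n) :
  T (\sum_(i <- r | P i) f i) = \sum_(i <- r | P i) T (f i).
Proof. exact: (big_morph _ rlinD rlin0). Qed.
End RealLinear.

(** * Rayleigh quotients, unitary matrices, rotations and reflections *)

Section Hermitian.
Variable n : nat.
Implicit Types (x y z : 'cV[F]_n) (A B G H K U : 'M[F]_n).

Lemma herm_form_eq0 H : ct H = H -> (forall x, rd x (H *m x) = 0) -> H = 0.
Proof.
move=> hH h; apply/matrixP => i j.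
have e : H *m delta_mx j 0 = 0 :> 'cV_n.
  apply: (rd_ext) => y; have := h (y + delta_mx j 0).
  rewrite mulmxDr rdDr !rdDl !h (rd_mulr _ H) hH (rdC (H *m _)).
  by rewrite add0r addr0 -mulr2n => /eqP; rewrite mulrn_eq0 => /eqP.
by rewrite -colE in e; move/colP/(_ i): e; rewrite !mxE.
Qed.

Definition isMin G y := forall x, rd y (G *m y) * nq x <= rd x (G *m x) * nq y.

Lemma quad_ge0_lin0 (b c : R) : (forall t, 0 <= 2 * t * b + t ^+ 2 * c) -> b = 0.
Proof.
move=> h; apply/eqP/negPn/negP => b0.
have c0 : 0 <= c by have := h 1; have := h (-1); lra.
(* The vertex is at -b/c; c + 1 keeps the denominator positive when c = 0 and still gives a negative
   value. *)
have := h (- b / (c + 1)).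
have p : 0 < c + 1 by lra.
have -> : 2 * (- b / (c + 1)) * b + (- b / (c + 1)) ^+ 2 * c =
   - (b ^+ 2 * (c + 2)) / (c + 1) ^+ 2 by field; rewrite gt_eqF.
rewrite leNgt mulNr oppr_lt0 divr_gt0 ?exprn_gt0 // mulr_gt0 //; last by lra.
by rewrite lt_def sqrf_eq0 b0 sqr_ge0.
Qed.

(** First variation: along y + tv minimality is a quadratic in t without constant term, so its
    linear coefficient, the pairing of v with Gy - ly, vanishes. *)
Lemma isMin_eigen G y : ct G = G -> y != 0 -> isMin G y ->
  G *m y = emb (rd y (G *m y) / nq y) *: y.
Proof.
move=> hG y0 hm; have yp : 0 < nq y by rewrite nq_gt0.
set l := _ / _; apply/eqP; rewrite -subr_eq0; apply/eqP.
have el : rd y (G *m y) = l * nq y by rewrite /l divfK // gt_eqF.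
apply: (rd_ext) => v; rewrite rdBr rdZr.
apply: (@quad_ge0_lin0 _ (rd v (G *m v) - l * nq v)) => t.
have := hm (y + emb t *: v); rewrite el mulrAC ler_pM2r //.
rewrite mulmxDr -scalemxAr !(rdDr, rdDl, rdZr, rdZl) nqD nqZ nrm2_emb rdZr el.
by rewrite (rd_mulr v G y) hG (rdC y (_ *m v)) (rdC y v); lra.
Qed.

Definition unitary U := ct U *m U = 1%:M.

Lemma unitaryC U : unitary U -> U *m ct U = 1%:M.
Proof. exact: mulmx1C. Qed.
Lemma unitary_ct U : unitary U -> unitary (ct U).
Proof. by move=> h; rewrite /unitary ctK; apply: mulmx1C. Qed.
Lemma unitaryM U V : unitary U -> unitary V -> unitary (U *m V).
Proof. by move=> hU hV; rewrite /unitary ctM mulmxA -(mulmxA (ct V)) hU mulmx1. Qed.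
Lemma unitary1 : unitary 1%:M.
Proof. by rewrite /unitary ct1 mulmx1. Qed.
Lemma unitary_nq U x : unitary U -> nq (U *m x) = nq x.
Proof. by move=> h; rewrite -!rdxx rd_mulr mulmxA h mul1mx. Qed.

(** With c and s the cosine and sine of an angle t, this matrix is exp(tK). *)
Lemma unitary_rot K Q (c s : R) : skewp K Q -> c ^+ 2 + s ^+ 2 = 1 ->
  unitary (1%:M + emb (c - 1) *: Q + emb s *: K).
Proof.
case=> hK hQ KK QK KQ cs.
have QQ : Q *m Q = Q by rewrite -{1}[Q]opprK -KK mulNmx -mulmxA KQ KK opprK.
rewrite /unitary !ctD ct1 !ctZ !cj_emb hK hQ.
rewrite !(mulmxDl, mulmxDr) !mul1mx !mulmx1 -!scalemxAl -!scalemxAr !mulNmx KK QK KQ QQ.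
have e : emb s * emb s = 1 - emb c * emb c.
  by rewrite -!rmorphM -(rmorph1 emb) -rmorphB; congr (emb _); lra.
apply/matrixP => i j; rewrite !mxE rmorphB rmorph1.
set q := Q i j; set u := K i j; set d := _ *+ _.
rewrite opprK (mulrA (emb s) (emb s) q) e.
ring.
Qed.

Lemma unitary_refl z : nq z = 1 -> unitary (1%:M - oproj z z *+ 2).
Proof.
move=> z1; have PP : oproj z z *m oproj z z = oproj z z.
  by rewrite oproj_mull oprojE dotxx z1 rmorph1 scale1r.
rewrite /unitary ctB ct1 mulr2n ctD ct_oproj.
rewrite mulmxBl !mulmxBr !mul1mx !mulmx1 mulmxDl !mulmxDr PP.
by apply/matrixP => i j; rewrite !mxE; ring.
Qed.

(** An orthogonal projection attains its norm at every vector that it fixes. *)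
Lemma refl_orth_isL y z : nq z = 1 -> dot z y = 0 -> isL (1%:M - oproj z z) y.
Proof.
move=> z1 zy x; rewrite ctB ct1 ct_oproj.
have e v : nq ((1%:M - oproj z z) *m v) = nq v - nrm2 (dot z v).
  rewrite mulmxBl mul1mx oprojE nqB nqZ z1 mulr1 /rd dotZr (dotC z v) mulcj re_emb.
  by ring.
by rewrite !e zy nrm2_0 subr0 mulrC ler_wpM2l ?nq_ge0 // gerBl nrm2_ge0.
Qed.

End Hermitian.

(** * The symmetrized product AB^* + BA^* *)

Section Bracket.
Variable n : nat.
Implicit Types A B C : 'M[F]_n.

(** Polarization of A |-> 2 AA^*; thus [isR (br A A)] says that A is a multiple of a unitary
    matrix. *)
Definition br A B := A *m ct B + B *m ct A.

Lemma brC A B : br A B = br B A. Proof. exact: addrC. Qed.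
Lemma ct_br A B : ct (br A B) = br A B.
Proof. by rewrite /br ctD !ctM !ctK addrC. Qed.
Lemma brDl A B C : br (A + B) C = br A C + br B C.
Proof. by rewrite /br ctD mulmxDl mulmxDr addrACA. Qed.
Lemma brZl a A B : br (emb a *: A) B = emb a *: br A B.
Proof. by rewrite /br ctZ cj_emb -scalemxAl -scalemxAr scalerDr. Qed.
Lemma brDr A B C : br C (A + B) = br C A + br C B.
Proof. by rewrite !(brC C) brDl. Qed.
Lemma brZr a A B : br B (emb a *: A) = emb a *: br B A.
Proof. by rewrite !(brC B) brZl. Qed.
Lemma brNl A B : br (- A) B = - br A B.
Proof. by rewrite -scaleN1r -(rmorphN1 emb) brZl rmorphN1 scaleN1r. Qed.
Lemma brNr A B : br B (- A) = - br B A.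
Proof. by rewrite !(brC B) brNl. Qed.
Lemma rd_br A x : rd x (br A A *m x) = 2 * nq (ct A *m x).
Proof.
by rewrite /br mulmxDl rdDr -!mulmxA rd_mulr rdxx; ring.
Qed.
End Bracket.

(** * The map k and its bijectivity on Hermitian matrices *)

Section KMap.
Variables (n : nat) (T : 'M[F]_n -> 'M[F]_n).
Hypothesis n_gt0 : (0 < n)%N.
Hypothesis T_lin : forall a A B, T (emb a *: A + B) = emb a *: T A + T B.
Hypothesis T_surj : forall B, exists A, T A = B.
Hypothesis T_inj : forall A, T A = 0 -> A = 0.
Hypothesis T_su : forall U, unitary U -> isR (br (T U) (T U)).
Implicit Types (y z : 'cV[F]_n) (H K Q Z : 'M[F]_n).

Definition kmap Z := br (T Z) (T 1%:M).
Local Notation k := kmap.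

Lemma kmap_lin a Z Z' : k (emb a *: Z + Z') = emb a *: k Z + k Z'.
Proof. by rewrite /k T_lin brDl brZl. Qed.
Lemma ct_kmap Z : ct (k Z) = k Z. Proof. exact: ct_br. Qed.

Let TD := rlinD T_lin.
Let TZ := rlinZ T_lin.
Let TB := rlinB T_lin.
Let kD := rlinD kmap_lin.
Let kZ := rlinZ kmap_lin.
Let kB := rlinB kmap_lin.

Lemma isR_br_diff (X Y : 'M[F]_n) : isR (br (X + Y) (X + Y)) -> isR (br (X - Y) (X - Y)) ->
  isR (br X Y).
Proof.
move=> h1 h2; have := isRZ 2^-1 (isRZ 2^-1 (isRB h1 h2)).
have -> : br (X + Y) (X + Y) - br (X - Y) (X - Y) = br X Y *+ 2 *+ 2.
  rewrite !(brDl, brDr, brNl, brNr) !(brC Y X).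
  by apply/matrixP => i j; rewrite !mxE; ring.
by rewrite mulr2n half_scale mulr2n half_scale.
Qed.

(* The rotations through an angle of cosine c and sine s and through the
   opposite angle have scaled unitary images; the cross term is then a real
   scalar matrix, and two values of c separate the two unknowns in it. *)
Lemma kmap_skew K : ct K = - K -> isR (k K).
Proof.
move: K; apply: (skew_ind (P := fun K => isR (k K))).
- by move=> A B hA hB; rewrite kD; apply: isRD.
- by move=> a A hA; rewrite kZ; apply: isRZ.
- by rewrite (rlin0 kmap_lin); apply: isR0.
move=> K Q hK _.
have key (c s : R) : c ^+ 2 + s ^+ 2 = 1 -> s != 0 ->
    isR (k K + emb (c - 1) *: br (T K) (T Q)).
  move=> cs s0.
  have u1 := T_su (unitary_rot hK cs).
  have cs' : c ^+ 2 + (- s) ^+ 2 = 1 by rewrite sqrrN.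
  have := T_su (unitary_rot hK cs').
  rewrite rmorphN scaleNr; move: u1; set X := 1%:M + _; rewrite TD TB TZ => h1 h2.
  have := isRZ s^-1 (isR_br_diff h1 h2).
  have e : emb s^-1 * emb s = 1 by rewrite -rmorphM mulVf // rmorph1.
  rewrite /X TD TZ brDl !brZr !brZl scalerDr !scalerA ?mulrA !e mul1r scale1r.
  by rewrite /k !(brC (T K)).
(* The points (0, 1) and (3/5, 4/5) of the unit circle have c - 1 equal to -1 and -2/5; the weights
   5/3 and -2/3 used below cancel the cross term and leave k K. *)
have h1 : isR (k K + emb (0 - 1) *: br (T K) (T Q)).
  by apply: (key 0 1); [ring | exact: oner_neq0].
have h2 : isR (k K + emb (3 / 5 - 1) *: br (T K) (T Q)).
  by apply: (key (3 / 5) (4 / 5)); [field | rewrite mulf_neq0 ?invr_eq0 ?pnatr_eq0].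
have := isRB (isRZ (5 / 3) h2) (isRZ (2 / 3) h1).
move: (k K) (br (T K) (T Q)) => X Y.
rewrite !scalerDr !scalerA -!rmorphM opprD addrACA -!scalerBl -!rmorphB.
have -> : 5 / 3 - 2 / 3 = 1 :> R by field.
have -> : 5 / 3 * (3 / 5 - 1) - 2 / 3 * (0 - 1) = 0 :> R by field.
by rewrite rmorph0 rmorph1 scale0r scale1r addr0.
Qed.

Lemma mulct_eq0 (A : 'M[F]_n) : A *m ct A = 0 -> A = 0.
Proof.
move=> h; rewrite -[A]ctK; suff -> : ct A = 0 by rewrite ct0.
apply/matrixP => i j.
have : ct A *m delta_mx j 0 = 0 :> 'cV_n.
  have := rd_br A (delta_mx j 0); rewrite /br h addr0 mul0mx rd0r => /esym/eqP.
  by rewrite mulf_eq0 pnatr_eq0 nq_eq0 => /eqP.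
by rewrite -colE => /matrixP/(_ i 0); rewrite !mxE.
Qed.

Lemma kmap1 : exists2 r, r != 0 & k 1%:M = (emb r)%:M /\
  T 1%:M *m ct (T 1%:M) = (emb (r / 2))%:M.
Proof.
have [r hr] := T_su (unitary1 n).
have e : T 1%:M *m ct (T 1%:M) = (emb (r / 2))%:M.
  have := half_scale (T 1%:M *m ct (T 1%:M)); rewrite -/(br _ _) hr => <-.
  by rewrite scale_scalar_mx -rmorphM mulrC.
exists r; last by split.
apply/eqP => r0; rewrite r0 mul0r rmorph0 raddf0 in e.
move/mulct_eq0/T_inj/matrixP/(_ (Ordinal n_gt0) (Ordinal n_gt0)): e.
by rewrite !mxE eqxx => /eqP; rewrite oner_eq0.
Qed.

Lemma kmap_herm_part Z : exists r, k Z = k (emb 2^-1 *: (Z + ct Z)) + (emb r)%:M.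
Proof.
have [|r e] := @kmap_skew (emb 2^-1 *: (Z - ct Z)).
  by rewrite ctZ cj_emb ctB ctK -scalerN opprB.
exists r; rewrite -e -kD -scalerDr; congr (k _).
by rewrite addrACA subrr addr0 half_scale.
Qed.

Lemma kmap_surj H : ct H = H -> exists2 K, ct K = K & k K = H.
Proof.
move=> hH; have [r r0 [k1 e]] := kmap1.
(* As T(1)T(1)^* is the scalar r/2, each of the two terms of k(Z) equals H/2. *)
have [Z hZ] := T_surj (emb r^-1 *: (H *m T 1%:M)).
have kZH : k Z = H.
  rewrite /k /br hZ -scalemxAl -mulmxA e ctZ ctM hH cj_emb -scalemxAr mulmxA e.
  rewrite mul_mx_scalar mul_scalar_mx !scalerA -rmorphM -scalerDl -rmorphD.
  have -> : r^-1 * (r / 2) + r^-1 * (r / 2) = 1 by field.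
  by rewrite rmorph1 scale1r.
have [s hs] := kmap_herm_part Z.
(* Since k(1) = r, the scalar s left by the skew part is absorbed in a multiple of 1. *)
exists (emb 2^-1 *: (Z + ct Z) + emb (s / r) *: 1%:M).
  by rewrite ctD !ctZ !cj_emb ctD ctK ct1 (addrC (ct Z)).
by rewrite kD (kZ (s / r)) k1 scale_scalar_mx -rmorphM divfK // -hs.
Qed.

(** [fin_dim] concerns endomorphisms of all matrices, so k on the Hermitian part is completed by the
    identity on the skew part; this map is surjective, hence injective. *)
Lemma kmap_inj0 K : ct K = K -> k K = 0 -> K = 0.
Proof.
pose g Z := k (emb 2^-1 *: (Z + ct Z)) + emb 2^-1 *: (Z - ct Z).
move=> hK kK; apply: (fin_dim (s := S) (g := g)).
- move=> a A B; rewrite /g ctD ctZ cj_emb.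
  have -> : emb 2^-1 *: (emb a *: A + B + (emb a *: ct A + ct B)) =
    emb a *: (emb 2^-1 *: (A + ct A)) + emb 2^-1 *: (B + ct B).
    by apply/matrixP => i j; rewrite !mxE; ring.
  rewrite kmap_lin; apply/matrixP => i j; rewrite !mxE; ring.
- move=> B; have [|L hL kL] := @kmap_surj (emb 2^-1 *: (B + ct B)).
    by rewrite ctZ ctD ctK cj_emb addrC.
  exists (L + emb 2^-1 *: (B - ct B)).
  rewrite /g ctD ctZ cj_emb hL ctB ctK.
  have -> : L + emb 2^-1 *: (B - ct B) + (L + emb 2^-1 *: (ct B - B)) = L + L.
    by apply/matrixP => i j; rewrite !mxE; ring.
  have -> : L + emb 2^-1 *: (B - ct B) - (L + emb 2^-1 *: (ct B - B)) =
     emb 2^-1 *: (B - ct B) + emb 2^-1 *: (B - ct B).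
    by apply/matrixP => i j; rewrite !mxE; ring.
  by rewrite !half_scale kL -scalerDr addrACA subrr addr0 half_scale.
- by rewrite /g hK subrr scaler0 addr0 half_scale.
Qed.

Lemma kmap_inj K : ct K = K -> isR (k K) -> isR K.
Proof.
move=> hK [s hs]; have [r r0 [k1 _]] := kmap1; exists (s / r).
apply/eqP; rewrite -subr_eq0; apply/eqP/kmap_inj0.
  by rewrite ctB hK ct_scalar cj_emb.
have -> : (emb (s / r))%:M = emb (s / r) *: 1%:M :> 'M[F]_n.
  by rewrite scale_scalar_mx mulr1.
by rewrite kB kZ k1 hs scale_scalar_mx -rmorphM divfK // subrr.
Qed.

(* With P the projection onto z, the image of the reflection 1 - 2P is scaled
   unitary, so T(P)T(P)^* agrees with k(P) up to a real scalar. *)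
Lemma kmap_isMin y y' z : dot z y = 0 ->
  (forall B, isL B y -> isL (T B) y') -> isMin (k (oproj z z)) y'.
Proof.
have [->|z0] := eqVneq z 0.
  have -> : oproj (0 : 'cV_n) 0 = 0 by rewrite /oproj mul0mx.
  by move=> _ _ x; rewrite (rlin0 kmap_lin) !mul0mx !rd0r !mul0r.
have [a a0 z1] := unit_scale z0.
move=> zy hB; pose u := emb a *: z; pose P := oproj u u.
have uy : dot u y = 0 by rewrite dotZl zy mulr0.
have eP : P = emb (a ^+ 2) *: oproj z z.
  by rewrite /P oprojZl oprojZr scalerA cj_emb -rmorphM.
have hL := hB _ (refl_orth_isL z1 uy).
have [r0 h0] := T_su (unitary1 n).
have [r1 h1] := T_su (unitary_refl z1).
have [r e] : isR (br (T (1%:M - P)) (T (1%:M - P)) + k P).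
  (* With X = T(1) and Y = T(P), both sides are br X X - br X Y + br Y Y; r0 and r1 are the values
     of [br] at X and at X - 2Y. *)
  exists (3 / 4 * r0 + 4^-1 * r1).
  have -> : (emb (3 / 4 * r0 + 4^-1 * r1))%:M =
     emb (3 / 4) *: (emb r0)%:M + emb 4^-1 *: (emb r1)%:M :> 'M[F]_n.
    by rewrite !scale_scalar_mx -!rmorphM -raddfD /= -rmorphD.
  rewrite -h0 -h1 mulr2n !TB TD /k -/P; move: (T 1%:M) (T P) => X Y.
  rewrite !(brDl, brDr, brNl, brNr) !(brC Y X) rmorphM fmorphV !emb_nat.
  move: (br X X) (br X Y) (br Y Y) => XX XY YY.
  apply/matrixP => i j; rewrite !mxE; field; by rewrite -emb_nat emb_eq0 pnatr_eq0.
(* k(P) is a scalar minus 2 T(1-P)T(1-P)^*, which turns norm attainment into minimality. *)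
have qk x : rd x (k P *m x) = r * nq x - 2 * nq (ct (T (1%:M - P)) *m x).
  have -> : k P = (emb r)%:M - br (T (1%:M - P)) (T (1%:M - P)).
    by rewrite -e addrAC subrr add0r.
  by rewrite mulmxBl rdBr mul_scalar_mx rdZr rdxx rd_br.
have hm : isMin (k P) y' by move=> x; rewrite !qk; have := hL x; rewrite /P; lra.
move=> x; have := hm x; rewrite eP kZ -!scalemxAl !rdZr.
by rewrite -[X in X <= _ -> _]mulrA -[X in _ <= X -> _]mulrA ler_pM2l ?exprn_gt0.
Qed.

End KMap.

(** * The correspondence of directions induced by k *)

Section Directions.
Variables (n : nat) (k : 'M[F]_n -> 'M[F]_n).
Hypothesis n_gt2 : (2 < n)%N.
Hypothesis k_lin : forall a A B, k (emb a *: A + B) = emb a *: k A + k B.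
Hypothesis ct_k : forall Z, ct (k Z) = k Z.
Hypothesis k_1 : isR (k 1%:M).
Hypothesis k_surj : forall H, ct H = H -> exists2 K, ct K = K & k K = H.
Hypothesis k_inj : forall K, ct K = K -> isR (k K) -> isR K.
Implicit Types (x y z v w : 'cV[F]_n) (G H K N Q Z : 'M[F]_n).

Let kD := rlinD k_lin.
Let kZ := rlinZ k_lin.
Let kB := rlinB k_lin.

Lemma mulmx_ext (A B : 'M[F]_n) : (forall x : 'cV_n, A *m x = B *m x) -> A = B.
Proof.
move=> h; apply/matrixP => i j; have := h (delta_mx j 0).
by rewrite -!colE => /colP/(_ i); rewrite !mxE.
Qed.

Definition perp y w := w - (dot y w / emb (nq y)) *: y.

Lemma dot_perp y w : y != 0 -> dot y (perp y w) = 0.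
Proof.
by move=> y0; rewrite /perp dotBr dotZr dotxx divfK ?subrr // emb_eq0 nq_eq0.
Qed.
Lemma perpD y w w' : perp y (w + w') = perp y w + perp y w'.
Proof. by rewrite /perp dotDr mulrDl scalerDl opprD addrACA. Qed.
Lemma perpZ y a w : perp y (a *: w) = a *: perp y w.
Proof. by rewrite /perp dotZr -mulrA scalerBr scalerA. Qed.
Lemma perp_self y c : y != 0 -> perp y (c *: y) = 0.
Proof.
by move=> y0; rewrite /perp dotZr dotxx mulfK ?subrr // emb_eq0 nq_eq0.
Qed.
Lemma perp_id y w : dot y w = 0 -> perp y w = w.
Proof. by move=> h; rewrite /perp h mul0r scale0r subr0. Qed.
Lemma perp_split y w : w = perp y w + (dot y w / emb (nq y)) *: y.
Proof. by rewrite subrK. Qed.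

Lemma herm_eigen_real H y c : ct H = H -> y != 0 -> H *m y = c *: y ->
  c = emb (re c).
Proof.
move=> hH y0 e; apply: cj_real; have n0 : dot y y != 0 by rewrite dotxx_eq0.
apply: (mulIf n0); rewrite -dotZl -dotZr -e dot_mull hH.
by [].
Qed.

(** The range of a Hermitian matrix is orthogonal to its kernel, so N maps into the line of y. *)
Lemma herm_rank1 N y : ct N = N -> y != 0 ->
  (forall v, dot y v = 0 -> N *m v = 0) ->
  N = emb (rd y (N *m y) / nq y ^+ 2) *: oproj y y.
Proof.
move=> hN y0 h; have nz : emb (nq y) != 0 by rewrite emb_eq0 nq_eq0.
have e : N *m y = (dot y (N *m y) / emb (nq y)) *: y.
  apply/eqP; rewrite -subr_eq0 -/(perp _ _) -dotxx_eq0.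
  have hp : N *m perp y (N *m y) = 0 by rewrite h // dot_perp.
  have p0 := dot_perp (N *m y) y0.
  rewrite {2}/perp dotBr dotZr dot_mulr hN hp dot0l (dotC y (perp _ _)) p0 rmorph0 mulr0 subr0.
  by [].
have cr := herm_eigen_real hN y0 e.
have e2 : re (dot y (N *m y) / emb (nq y)) = rd y (N *m y) / nq y.
  by rewrite mulrC -fmorphV re_embM mulrC.
rewrite e2 in cr; rewrite cr in e; move: e; set r := rd _ _ => e.
apply: mulmx_ext => x; rewrite {1}(perp_split y x) mulmxDr h ?dot_perp // add0r.
rewrite -scalemxAr e -scalemxAl oprojE !scalerA; congr (_ *: _).
by rewrite !rmorphM !fmorphV rmorphXn /=; field.
Qed.

Lemma isMin_eigen_eq G y1 y2 : ct G = G -> y1 != 0 -> y2 != 0 ->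
  isMin G y1 -> isMin G y2 ->
  exists l, G *m y1 = emb l *: y1 /\ G *m y2 = emb l *: y2.
Proof.
move=> hG n1 n2 h1 h2; exists (rd y1 (G *m y1) / nq y1).
split; first exact: isMin_eigen.
suff -> : rd y1 (G *m y1) / nq y1 = rd y2 (G *m y2) / nq y2 by exact: isMin_eigen.
have p1 : 0 < nq y1 by rewrite nq_gt0.
have p2 : 0 < nq y2 by rewrite nq_gt0.
apply/le_anti/andP; split.
  by rewrite ler_pdivrMr // mulrAC ler_pdivlMr.
by rewrite ler_pdivrMr // mulrAC ler_pdivlMr.
Qed.

(** All that is retained of norm attainment in what follows. *)
Definition dirn y' y := [/\ y' != 0, y != 0 &
  forall z, dot z y = 0 -> isMin (k (oproj z z)) y'].

(* N is a real combination of matrices zz^* with z orthogonal to y1 and y2, and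
   the minimum of the form of k(zz^* ) is attained at y1' and at y2' alike. *)
Lemma dirn_kernel N y1' y1 y2' y2 : dirn y1' y1 -> dirn y2' y2 ->
  ct N = N -> N *m y1 = 0 -> N *m y2 = 0 ->
  exists l, k N *m y1' = emb l *: y1' /\ k N *m y2' = emb l *: y2'.
Proof.
case=> y1'0 y10 d1 [y2'0 y20 d2] hN N1 N2.
pose w := perp y1 y2.
(* Projection onto the complement of y1 and y2, by Gram-Schmidt; when y2 is parallel to y1, w = 0
   and the last term vanishes. *)
pose Q : 'M[F]_n := 1%:M - emb (nq y1)^-1 *: oproj y1 y1 - emb (nq w)^-1 *: oproj w w.
have wy1 : dot y1 w = 0 by apply: dot_perp.
have y1w : dot w y1 = 0 by rewrite dotC wy1 rmorph0.
have hQ : ct Q = Q by rewrite /Q !ctB ct1 !ctZ !ct_oproj !cj_emb.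
have Q1 : Q *m y1 = 0.
  rewrite /Q !mulmxBl mul1mx -!scalemxAl !oprojE y1w scale0r scaler0 subr0 dotxx.
  by rewrite scalerA -rmorphM mulVf ?nq_eq0 // rmorph1 scale1r subrr.
have Qw : Q *m w = 0.
  rewrite /Q !mulmxBl mul1mx -!scalemxAl !oprojE wy1 scale0r scaler0 subr0 dotxx.
  have [->|w0] := eqVneq w 0; first by rewrite !scaler0 subr0.
  by rewrite scalerA -rmorphM mulVf ?nq_eq0 // rmorph1 scale1r subrr.
have Q2 : Q *m y2 = 0.
  by rewrite (perp_split y1 y2) mulmxDr Qw -scalemxAr Q1 scaler0 addr0.
have Nw : N *m w = 0 by rewrite /w /perp mulmxBr N2 -scalemxAr N1 scaler0 subrr.
have NQ : N *m Q = N.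
  rewrite /Q !mulmxBr mulmx1 -!scalemxAr !oproj_mull N1 Nw.
  by rewrite /oproj !mul0mx !scaler0 !subr0.
have QNQ : Q *m N *m Q = N by rewrite -mulmxA NQ -[RHS]hN -{2}NQ ctM hQ hN.
(* Inducting on the N inside QNQ turns each generator zz^* into one for Qz, which is orthogonal to
   y1 and y2. *)
rewrite -QNQ; move: hN; clear NQ QNQ Nw N1 N2; clearbody Q.
move: N; apply: (herm_ind (P := fun N => exists l,
  k (Q *m N *m Q) *m y1' = emb l *: y1' /\ k (Q *m N *m Q) *m y2' = emb l *: y2')).
- move=> A B [a [a1 a2]] [b [b1 b2]]; exists (a + b).
  by rewrite mulmxDr mulmxDl kD !mulmxDl a1 a2 b1 b2 rmorphD !scalerDl.
- move=> a A [b [b1 b2]]; exists (a * b).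
  by rewrite -scalemxAr -scalemxAl kZ -!scalemxAl b1 b2 rmorphM !scalerA.
move=> z; rewrite oproj_mull oproj_mulr hQ.
apply: isMin_eigen_eq => //.
  by apply: d1; rewrite dot_mull hQ Q1 dot0r.
by apply: d2; rewrite dot_mull hQ Q2 dot0r.
Qed.

(** For w orthogonal to y, these represent the Hermitian matrices modulo those having y as an
    eigenvector. *)
Definition symp y w := oproj y w + oproj w y.

Lemma ct_symp y w : ct (symp y w) = symp y w.
Proof. by rewrite /symp ctD !ct_oproj addrC. Qed.
Lemma symp_lin y a v w : symp y (emb a *: v + w) = emb a *: symp y v + symp y w.
Proof.
rewrite /symp oprojDl oprojDr oprojZl oprojZr cj_emb.
by apply/matrixP => i j; rewrite !mxE; ring.
Qed.

(** K minus the [symp] term and a real multiple of 1 kills y, so by [dirn_kernel] its image has y'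
    as an eigenvector and contributes nothing orthogonal to y'. *)
Lemma perp_k_symp y' y K : dirn y' y -> ct K = K ->
  perp y' (k K *m y') =
  perp y' (k (symp y (emb (nq y)^-1 *: perp y (K *m y))) *m y').
Proof.
move=> d hK; case: (d) => y'0 y0 _.
have nz : emb (nq y) != 0 by rewrite emb_eq0 nq_eq0.
set w := emb _ *: _; pose N := K - symp y w.
have wy : dot y w = 0 by rewrite dotZr dot_perp // mulr0.
have yw : dot w y = 0 by rewrite dotC wy rmorph0.
have hN : ct N = N by rewrite ctB hK ct_symp.
have eN : N *m y = (dot y (K *m y) / emb (nq y)) *: y.
  rewrite mulmxBl mulmxDl !oprojE yw scale0r add0r dotxx /w scalerA -rmorphM.
  by rewrite mulfV ?nq_eq0 // rmorph1 scale1r {1}(perp_split y (K *m y)) addrAC subrr add0r.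
have cr := herm_eigen_real hN y0 eN.
set c := _ / _ in eN cr.
have [l [hl _]] : exists l, k (N - emb (re c) *: 1%:M) *m y' = emb l *: y' /\
   k (N - emb (re c) *: 1%:M) *m y' = emb l *: y'.
  apply: (dirn_kernel d d).
  - by rewrite ctB hN ctZ ct1 cj_emb.
  - by rewrite mulmxBl eN -scalemxAl mul1mx -cr subrr.
  - by rewrite mulmxBl eN -scalemxAl mul1mx -cr subrr.
have [r hr] := k_1.
move: hl; rewrite kB kZ hr mulmxBl -scalemxAl mul_scalar_mx /N kB mulmxBl.
move/eqP; rewrite subr_eq => /eqP; rewrite scalerA -scalerDl.
move/eqP; rewrite subr_eq => /eqP ->.
by rewrite perpD perp_self // add0r.
Qed.

(* [g] below is surjective since k is, hence injective: this replaces a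
   comparison of the dimensions of the spaces of Hermitian matrices having y,
   respectively y', as an eigenvector. *)
Lemma dirn_eigen y' y K c : dirn y' y -> ct K = K -> k K *m y' = c *: y' ->
  exists d, K *m y = d *: y.
Proof.
move=> d hK e; case: (d) => y'0 y0 _.
have nz : emb (nq y) != 0 by rewrite emb_eq0 nq_eq0.
have nz' : emb (nq y') != 0 by rewrite emb_eq0 nq_eq0.
(* The second summand carries the component along y to the line of y', completing a map between the
   two complements to an endomorphism. *)
pose g w := perp y' (k (symp y (perp y w)) *m y') + dot y w *: y'.
have g_lin a v w : g (emb a *: v + w) = emb a *: g v + g w.
  rewrite /g perpD perpZ symp_lin k_lin mulmxDl perpD -scalemxAl perpZ.
  by rewrite dotDr dotZr scalerDl -scalerA addrACA -scalerDr.
have g_surj v : exists w, g w = v.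
  pose u := perp y' v; pose H := symp y' u.
  have uy' : dot u y' = 0 by rewrite dotC dot_perp // rmorph0.
  have [L hL kL] := k_surj (ct_symp y' u).
  pose w := emb (nq y)^-1 *: perp y (L *m y).
  have yw : dot y w = 0 by rewrite dotZr dot_perp // mulr0.
  have ew : perp y' (k (symp y w) *m y') = emb (nq y') *: u.
    rewrite -(perp_k_symp d hL) kL mulmxDl !oprojE uy' scale0r add0r dotxx perpZ.
    by rewrite perp_id // dot_perp.
  clearbody w; exists (emb (nq y')^-1 *: w + (dot y' v / emb (nq y') / emb (nq y)) *: y).
  rewrite /g perpD perpZ perp_self // addr0 (perp_id yw).
  have -> : symp y (emb (nq y')^-1 *: w) = emb (nq y')^-1 *: symp y w.
    by have := symp_lin y (nq y')^-1 w 0; rewrite addr0 => ->; rewrite /symp /oproj ct0 mulmx0 mul0mx !addr0.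
  rewrite kZ -scalemxAl perpZ ew scalerA -rmorphM mulVf ?nq_eq0 // rmorph1 scale1r.
  rewrite dotDr !dotZr yw mulr0 add0r dotxx divfK //.
  by rewrite -perp_split.
pose w := emb (nq y)^-1 *: perp y (K *m y).
have : w = 0.
  apply: (fin_dim (s := S) g_lin g_surj).
  have yw : dot y w = 0 by rewrite dotZr dot_perp // mulr0.
  by rewrite /g yw scale0r addr0 (perp_id yw) /w -(perp_k_symp d hK) e perp_self.
move/eqP; rewrite scaler_eq0 emb_eq0 invr_eq0 nq_eq0 (negbTE y0) => /= /eqP p0.
by exists (dot y (K *m y) / emb (nq y)); rewrite {1}(perp_split y (K *m y)) p0 add0r.
Qed.

(** The preimage K of y1'y1'^* has y1 and y2 as eigenvectors by [dirn_eigen]. Were they not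
    orthogonal, their eigenvalues would agree and [dirn_kernel] would give y1' and y2' the same
    eigenvalue of y1'y1'^*, though these are |y1'|^2 and 0. *)
Lemma dirn_orth y1' y1 y2' y2 : dirn y1' y1 -> dirn y2' y2 ->
  dot y1' y2' = 0 -> dot y1 y2 = 0.
Proof.
move=> d1 d2 o; case: (d1) (d2) => n1' n1 _ [n2' n2 _].
apply/eqP/negPn/negP => nz.
have o' : dot y2' y1' = 0 by rewrite dotC o rmorph0.
have [K hK kK] := @k_surj (oproj y1' y1') (ct_oproj _ _).
have [c1 e1] : exists c, K *m y1 = c *: y1.
  by apply: (dirn_eigen (c := emb (nq y1')) d1 hK); rewrite kK oprojE dotxx.
have [c2 e2] : exists c, K *m y2 = c *: y2.
  by apply: (dirn_eigen (c := 0) d2 hK); rewrite kK oprojE o scale0r scale0r.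
have r1 := herm_eigen_real hK n1 e1.
have c12 : c2 = c1.
  apply: (mulIf nz); rewrite -dotZr -e2 dot_mulr hK e1 dotZl r1 cj_emb.
  by [].
have [l [l1 l2]] : exists l, k (K - emb (re c1) *: 1%:M) *m y1' = emb l *: y1' /\
   k (K - emb (re c1) *: 1%:M) *m y2' = emb l *: y2'.
  apply: (dirn_kernel d1 d2).
  - by rewrite ctB hK ctZ ct1 cj_emb.
  - by rewrite mulmxBl e1 -scalemxAl mul1mx r1 re_emb subrr.
  - by rewrite mulmxBl e2 c12 -scalemxAl mul1mx r1 re_emb subrr.
have [r hr] := k_1.
move: l1; rewrite kB kZ hr kK mulmxBl -scalemxAl mul_scalar_mx oprojE dotxx scalerA.
move/eqP; rewrite -scalerBl -subr_eq0 -scalerBl scaler_eq0 (negbTE n1') orbF => /eqP h1.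
move: l2; rewrite kB kZ hr kK mulmxBl -scalemxAl mul_scalar_mx oprojE o scalerA scale0r -(scale0r y2').
move/eqP; rewrite -scalerBl -subr_eq0 -scalerBl scaler_eq0 (negbTE n2') orbF sub0r => /eqP h2.
move: n1'; rewrite -nq_eq0 -emb_eq0.
have -> : emb (nq y1') = (emb (nq y1') - emb (re c1) * emb r - emb l) - (- (emb (re c1) * emb r) - emb l) by ring.
by rewrite h1 h2 subrr eqxx.
Qed.

Hypothesis dirn_ex : forall y', y' != 0 -> exists y, dirn y' y.

(** For v orthogonal to y', the partner of v is orthogonal to y, so the form of k(yy^* ) is minimal
    at v. Hence k(yy^* ) is one constant on the complement of y'; minimality gives m >= 0,
    injectivity modulo scalars excludes m = 0. *)
Lemma dirn_rank1 y' y : dirn y' y ->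
  exists2 m, 0 < m & isR (k (oproj y y) - emb m *: oproj y' y').
Proof.
move=> d; case: (d) => y'0 y0 _.
set G := k (oproj y y); have hG : ct G = G by apply: ct_k.
have hmin v : v != 0 -> dot y' v = 0 -> isMin G v.
  move=> v0 o; have [u du] := dirn_ex v0; case: (du) => _ _; apply.
  exact: dirn_orth d du o.
have [w w0 [o _]] := orth_pair y' y' n_gt2.
pose l := rd w (G *m w) / nq w.
pose N := G - (emb l)%:M.
have hN : ct N = N by rewrite ctB hG ct_scalar cj_emb.
have N0 v : dot y' v = 0 -> N *m v = 0.
  move=> ov; have [->|v0] := eqVneq v 0; first by rewrite mulmx0.
  have [m [m1 m2]] := isMin_eigen_eq hG w0 v0 (hmin _ w0 o) (hmin _ v0 ov).
  have e : emb l = emb m.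
    have := isMin_eigen hG w0 (hmin _ w0 o); rewrite -/l m1 => /eqP.
    by rewrite -subr_eq0 -scalerBl scaler_eq0 (negbTE w0) orbF subr_eq0 => /eqP.
  by rewrite mulmxBl m2 mul_scalar_mx e subrr.
have eN := herm_rank1 hN y'0 N0.
set m := rd _ _ / _ in eN.
have eG : G - emb m *: oproj y' y' = (emb l)%:M by rewrite -eN opprB addrC subrK.
exists m; last by exists l.
have m0 : 0 <= m.
  rewrite divr_ge0 ?sqr_ge0 // mulmxBl rdBr mul_scalar_mx rdZr rdxx /l.
  have := hmin _ w0 o y'; have := w0; rewrite -nq_gt0 => wp h.
  by rewrite subr_ge0 mulrAC ler_pdivrMr.
rewrite lt_def m0 andbT; apply/eqP => me.
have [|s hs] := @k_inj (oproj y y) (ct_oproj _ _).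
  by exists l; rewrite -eG me rmorph0 scale0r subr0.
have [v v0 [ov _]] := orth_pair y y n_gt2.
have e1 : oproj y y *m v = 0 by rewrite oprojE ov scale0r.
have e2 : oproj y y *m y = 0.
  move: e1; rewrite hs !mul_scalar_mx => /eqP; rewrite scaler_eq0 (negbTE v0) orbF => /eqP ->.
  by rewrite scale0r.
move: e2; rewrite oprojE => /eqP; rewrite scaler_eq0 dotxx_eq0 (negbTE y0).
by [].
Qed.

End Directions.

(** * Wigner's theorem: diagonal normalization and images of coordinate pairs *)

Section Wigner.
Variable n : nat.
Hypothesis n_gt2 : (2 < n)%N.
Implicit Types (f y z v w : 'cV[F]_n) (A B G H U X : 'M[F]_n) (rho : 'M[F]_n -> 'M[F]_n).
Local Notation e_ i := (delta_mx i 0 : 'cV[F]_n).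
Local Notation E_ i := (delta_mx i i : 'M[F]_n).

(** A vector orthogonal to both x and y shows that the real scalar is 0. *)
Lemma oproj_line (a b : R) x y : 0 < a -> x != 0 ->
  isR (emb a *: oproj x x - emb b *: oproj y y) -> exists d, x = d *: y.
Proof.
move=> a0 x0 [r e].
have [w w0 [xw yw]] := orth_pair x y n_gt2.
have r0 : emb r = 0.
  have : (emb r)%:M *m w = 0.
    by rewrite -e mulmxBl -!scalemxAl !oprojE xw yw !scale0r !scaler0 subrr.
  by rewrite mul_scalar_mx => /eqP; rewrite scaler_eq0 (negbTE w0) orbF => /eqP.
rewrite r0 raddf0 in e.
have : (emb a *: oproj x x - emb b *: oproj y y) *m x = 0 by rewrite e mul0mx.
rewrite mulmxBl -!scalemxAl !oprojE dotxx !scalerA => /eqP; rewrite subr_eq0 => /eqP h.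
have nz : emb a * emb (nq x) != 0.
  by rewrite mulf_neq0 ?emb_eq0 ?nq_eq0 // gt_eqF.
exists ((emb a * emb (nq x))^-1 * (emb b * dot y x)).
by rewrite -scalerA -h scalerA mulVf // scale1r.
Qed.

Lemma third (i j : 'I_n) : exists l, (l != i) && (l != j).
Proof.
apply/existsP; apply: contraLR n_gt2; rewrite negb_exists -leqNgt => /forallP h.
have sub : [set: 'I_n] \subset [set i; j].
  by apply/fintype.subsetP => l _; have := h l; rewrite !inE negb_and !negbK.
have := subset_leq_card sub; rewrite cardsT card_ord cards2 => /leq_trans; apply.
by case: (_ != _).
Qed.

Lemma ct_h2 (i j : 'I_n) a : ct (h2 i j a) = h2 i j a.
Proof. by rewrite /h2 ctD !ctZ !ct_delta cjK addrC. Qed.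
Lemma h2_sym (i j : 'I_n) a : h2 j i (cj a) = h2 i j a.
Proof. by rewrite /h2 cjK addrC. Qed.
Lemma h2_lin (i j : 'I_n) s a b : h2 i j (emb s * a + b) = emb s *: h2 i j a + h2 i j b.
Proof.
rewrite /h2 rmorphD rmorphM cj_emb.
by apply/matrixP => p q; rewrite !mxE; ring.
Qed.

Lemma isR_offdiag X (p q : 'I_n) : p != q -> isR X -> X p q = 0.
Proof. by move=> pq [r ->]; rewrite mxE (negbTE pq) mulr0n. Qed.

Lemma h2_inj (i j : 'I_n) a b : i != j -> isR (h2 i j a - h2 i j b) -> a = b.
Proof.
move=> ij /(isR_offdiag ij); rewrite !mxE !eqxx (negbTE ij) (eq_sym j) (negbTE ij).
by rewrite /= !mulr0 !addr0 !mulr1 => /eqP; rewrite subr_eq0 => /eqP.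
Qed.

Definition rank1_rel rho y f := f != 0 /\
  exists2 c, 0 < c & isR (rho (oproj y y) - emb c *: oproj f f).

(** Wigner's hypotheses for a map known modulo real scalars; orthogonality is asked of all related
    pairs, as f is at best determined up to a factor. *)
Definition whyp rho :=
  [/\ forall a A B, rho (emb a *: A + B) = emb a *: rho A + rho B,
      forall H, ct H = H -> ct (rho H) = rho H, isR (rho 1%:M),
      forall y, y != 0 -> exists f, rank1_rel rho y f &
      forall y1 y2 f1 f2, rank1_rel rho y1 f1 -> rank1_rel rho y2 f2 ->
        dot y1 y2 = 0 -> dot f1 f2 = 0].

Definition conjm (c : R) (U : 'M[F]_n) (rho : 'M[F]_n -> 'M[F]_n) (H : 'M[F]_n) : 'M[F]_n :=
  emb c *: (ct U *m rho H *m U).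

Lemma isR_conj c U X : unitary U -> isR X -> isR (emb c *: (ct U *m X *m U)).
Proof.
move=> hU [r ->]; apply: isRZ; exists r.
by rewrite mul_mx_scalar -scalemxAl hU scale_scalar_mx mulr1.
Qed.

Lemma conj_oproj U f : ct U *m oproj f f *m U = oproj (ct U *m f) (ct U *m f).
Proof. by rewrite oproj_mull oproj_mulr. Qed.

Lemma conjm_rank1_rel c U rho y f : unitary U -> 0 < c ->
  rank1_rel rho y f -> rank1_rel (conjm c U rho) y (ct U *m f).
Proof.
move=> hU c0 [f0 [d d0 h]]; split.
  by rewrite -nq_eq0 unitary_nq ?nq_eq0 //; apply: unitary_ct.
exists (c * d); first exact: mulr_gt0.
have -> : conjm c U rho (oproj y y) - emb (c * d) *: oproj (ct U *m f) (ct U *m f)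
  = emb c *: (ct U *m (rho (oproj y y) - emb d *: oproj f f) *m U).
  rewrite /conjm mulmxBr mulmxBl scalerBr -scalemxAr -scalemxAl scalerA -rmorphM.
  by rewrite conj_oproj.
exact: isR_conj.
Qed.

Lemma conjmK c U rho H : unitary U -> c != 0 ->
  conjm c^-1 (ct U) (conjm c U rho) H = rho H.
Proof.
move=> hU c0; rewrite /conjm ctK -scalemxAr -scalemxAl scalerA -rmorphM mulVf //.
rewrite rmorph1 scale1r !mulmxA unitaryC // mul1mx -mulmxA unitaryC // mulmx1.
by [].
Qed.

Lemma rank1_rel_ext rho rho' y f : rho =1 rho' -> rank1_rel rho y f -> rank1_rel rho' y f.
Proof. by move=> h [f0 [c c0 hc]]; split=> //; exists c => //; rewrite -h. Qed.

Lemma whyp_conj c U rho : unitary U -> 0 < c -> whyp rho -> whyp (conjm c U rho).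
Proof.
move=> hU c0 [r_lin r_h r_1 r_ex r_o]; split.
- move=> a A B; rewrite /conjm r_lin mulmxDr mulmxDl -scalemxAr -scalemxAl scalerDr.
  by rewrite !scalerA mulrC.
- by move=> H hH; rewrite /conjm ctZ cj_emb !ctM ctK r_h // mulmxA.
- exact: isR_conj.
- by move=> y y0; have [f hf] := r_ex _ y0; exists (ct U *m f); apply: conjm_rank1_rel.
have back y f : rank1_rel (conjm c U rho) y f -> rank1_rel rho y (U *m f).
  move=> h; have hU' := unitary_ct hU; have c0' : 0 < c^-1 by rewrite invr_gt0.
  have := conjm_rank1_rel hU' c0' h; rewrite ctK; apply: rank1_rel_ext => H.
  by rewrite conjmK // gt_eqF.
move=> y1 y2 f1 f2 /back h1 /back h2 /(r_o _ _ _ _ h1 h2).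
by rewrite dot_mull mulmxA hU mul1mx.
Qed.

Definition diag_normal rho := forall i, isR (rho (E_ i) - E_ i).

(** Orthonormal images of the e_i form the columns of U; their weights are equal because the image
    of 1 is scalar. *)
Lemma whyp_diag rho : whyp rho ->
  exists c U, [/\ 0 < c, unitary U & diag_normal (conjm c U rho)].
Proof.
case=> r_lin r_h r_1 r_ex r_o.
have e0 i : e_ i != 0.
  by rewrite -nq_eq0 -emb_eq0 -dotxx /dot ct_delta mul_delta_mx mxE !eqxx oner_eq0.
have /choice[f hf] : forall i, exists f, rank1_rel rho (e_ i) f /\ nq f = 1.
  move=> i.
  have [f [f0 [c c0 hc]]] := r_ex _ (e0 i).
  have [a a0 f1] := unit_scale f0; exists (emb a *: f); split=> //; split.
    by rewrite -nq_eq0 f1 oner_eq0.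
  exists (c / a ^+ 2); first by rewrite divr_gt0 // exprn_gt0.
  rewrite oprojZl oprojZr cj_emb !scalerA -!rmorphM.
  by have -> : c / a ^+ 2 * a * a = c by field; rewrite gt_eqF.
have o i j : i != j -> dot (f i) (f j) = 0.
  move=> ij; apply: r_o (proj1 (hf i)) (proj1 (hf j)) _.
  by rewrite /dot ct_delta mul_delta_mx_cond (negbTE ij) mulr0n mxE.
pose U := \matrix_(p, j) (f j) p 0.
have Ue j : U *m e_ j = f j by rewrite -colE; apply/colP => p; rewrite !mxE.
have hU : unitary U.
  apply/matrixP => i j; rewrite [RHS]mxE.
  have -> : (ct U *m U) i j = dot (f i) (f j).
    by rewrite dotE mxE; apply: eq_bigr => p _; rewrite ctE !mxE.
  have [->|ij] := eqVneq i j; last by rewrite o // ?(negbTE ij).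
  by rewrite dotxx (proj2 (hf j)) rmorph1 ?eqxx.
have Uf j : ct U *m f j = e_ j by rewrite -Ue mulmxA hU mul1mx.
have /choice[c hc] : forall i, exists c, 0 < c /\ isR (rho (E_ i) - emb c *: oproj (f i) (f i)).
  by move=> i; have [[_ [c c0]]] := hf i; rewrite oproj_delta; exists c.
have hd a i : isR (conjm a U rho (E_ i) - emb (a * c i) *: E_ i).
  have := isR_conj a hU (proj2 (hc i)).
  rewrite mulmxBr mulmxBl -scalemxAr -scalemxAl conj_oproj Uf oproj_delta scalerBr.
  by rewrite scalerA -rmorphM.
have ceq i j : c i = c j.
  have [->//|ij] := eqVneq i j.
  have [r hr] : isR (\sum_l emb (c l) *: E_ l).
    have h1 := isR_conj 1 hU r_1.
    have h2 : isR (\sum_l (conjm 1 U rho (E_ l) - emb (1 * c l) *: E_ l)).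
      by apply: isR_sum => l _; apply: hd.
    have := isRB h1 h2; rewrite sumrB opprB.
    have -> : \sum_l conjm 1 U rho (E_ l) = emb 1 *: (ct U *m rho 1%:M *m U).
      rewrite mx1_sum_delta (rlin_sum r_lin) mulmx_sumr mulmx_suml scaler_sumr.
      by [].
    rewrite addrC subrK.
    by under eq_bigr do rewrite mul1r.
  have ent p : (\sum_l emb (c l) *: E_ l) p p = emb (c p).
    rewrite summxE (bigD1 p) //= big1 ?addr0; first by rewrite !mxE !eqxx mulr1.
    by move=> l lp; rewrite !mxE eq_sym (negbTE lp) mulr0.
  have := ent i; have := ent j; rewrite hr !mxE !eqxx !mulr1n.
  by move=> /emb_inj <- /emb_inj <-.
have i0 : 'I_n := Ordinal (ltn_trans (ltn0Sn 1) n_gt2).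
have ci0 := proj1 (hc i0).
exists (c i0)^-1, U; split=> //; first by rewrite invr_gt0.
move=> i; have := hd (c i0)^-1 i.
by rewrite (ceq i i0) mulVf ?gt_eqF // rmorph1 scale1r.
Qed.

Lemma diag_rank1_rel rho i : diag_normal rho -> rank1_rel rho (e_ i) (e_ i).
Proof.
move=> h; split.
  by rewrite -nq_eq0 -emb_eq0 -dotxx /dot ct_delta mul_delta_mx mxE !eqxx oner_eq0.
by exists 1 => //; rewrite oproj_delta rmorph1 scale1r.
Qed.

(** A zero coordinate is orthogonality to e_l, and e_l is related to itself. *)
Lemma rank1_rel_support rho y f l : whyp rho -> diag_normal rho -> rank1_rel rho y f ->
  y l 0 = 0 -> f l 0 = 0.
Proof.
case=> _ _ _ _ r_o hd hf yl.
have de v : dot (e_ l) v = v l 0.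
  by rewrite /dot ct_delta -rowE mxE.
by rewrite -de; apply: r_o (diag_rank1_rel l hd) hf _; rewrite de.
Qed.

(* For the vectors e_i + t conj(a) e_j, with t any real number, the image is
   E_ii + t^2 E_jj + t X up to a scalar; positivity for all t forces the
   diagonal of X to vanish, and rank one at t = 1 forces |X_ij| = 1. *)
Lemma pair_image rho i j a : whyp rho -> diag_normal rho -> i != j ->
  a * cj a = 1 ->
  exists2 b, b * cj b = 1 & isR (rho (h2 i j a) - h2 i j b).
Proof.
move=> hw hd ij a1; case: (hw) => r_lin r_h r_1 r_ex r_o.
have ji : j != i by rewrite eq_sym.
have [l0 /andP[l0i l0j]] := third i j.
set X := rho _; have hX : ct X = X by apply: r_h; apply: ct_h2.
have Xr p : X p p = emb (re (X p p)).
  by apply: cj_real; rewrite -{2}hX ctE.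
(* Each f below vanishes at the third index l0, so this entry identifies the unknown scalar and the
   relation becomes an equality. *)
pose X' := X - (X l0 l0)%:M.
have key (t : R) : exists c f, [/\ 0 < c,
    forall l, l != i -> l != j -> f l 0 = 0 &
    E_ i + emb (t ^+ 2) *: E_ j + emb t *: X' = emb c *: oproj f f].
  pose y : 'cV[F]_n := e_ i + (emb t * cj a) *: e_ j.
  have yi : y i 0 = 1 by rewrite !mxE !eqxx (negbTE ij) mulr0 addr0.
  have y0 : y != 0.
    by apply/eqP => /colP/(_ i)/eqP; rewrite yi mxE oner_eq0.
  have [f hf] := r_ex _ y0.
  have f0 l : l != i -> l != j -> f l 0 = 0.
    move=> li lj; apply: rank1_rel_support hw hd hf _.
    by rewrite !mxE (negbTE li) (negbTE lj) mulr0 addr0.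
  case: (hf) => _ [c c0 hc]; exists c, f; split=> //.
  have ey : oproj y y = E_ i + emb (t ^+ 2) *: E_ j + emb t *: h2 i j a.
    rewrite /y !(oprojDl, oprojDr, oprojZl, oprojZr) !oproj_delta /h2.
    rewrite rmorphM cjK cj_emb rmorphXn /=.
    have e : emb t ^+ 2 = (emb t * cj a) * (emb t * a).
      by rewrite mulrACA (mulrC (cj a)) a1 mulr1.
    by apply/matrixP => p q; rewrite !mxE e; ring.
  have [r hr] : isR (E_ i + emb (t ^+ 2) *: E_ j + emb t *: X - emb c *: oproj f f).
    have h1 := hd i; have h2 := isRZ (t ^+ 2) (hd j).
    have := isRB (isRB hc h1) h2; rewrite ey (rlinD r_lin) (rlinD r_lin) !(rlinZ r_lin) -/X.
    congr isR; apply/matrixP => p q; rewrite !mxE; ring.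
  have er : emb r = emb t * X l0 l0.
    have := congr1 (fun M : 'M_n => M l0 l0) hr.
    rewrite !mxE big_ord1 !mxE f0 // (negbTE l0i) (negbTE l0j) eqxx mulr1n => <-.
    by rewrite /=; ring.
  apply/eqP; rewrite -subr_eq0; apply/eqP.
  transitivity (E_ i + emb (t ^+ 2) *: E_ j + emb t *: X - emb c *: oproj f f
     - emb t *: (X l0 l0)%:M).
    rewrite /X'; move: (oproj f f) ((X l0 l0)%:M) => O L.
    by apply/matrixP => p q; rewrite !mxE; ring.
  by rewrite hr scale_scalar_mx er subrr.
have ent (t : R) : exists c f, [/\ 0 < c,
   forall l, l != i -> l != j -> f l 0 = 0 &
   forall p q, ((p == i) && (q == i))%:R + emb (t ^+ 2) * ((p == j) && (q == j))%:R +
     emb t * X' p q = emb c * (f p 0 * cj (f q 0))].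
  have [c [f [c0 f0 e]]] := key t; exists c, f; split=> // p q.
  by have := congr1 (fun M : 'M_n => M p q) e; rewrite !mxE big_ord1 !mxE.
have hX' : ct X' = X' by rewrite /X' ctB hX ct_scalar Xr cj_emb.
have X'r p : X' p p = emb (re (X' p p)).
  by apply: cj_real; rewrite -{2}hX' ctE.
have Xii : X' i i = 0.
  move: (X'r i); move: (re _) => x xi; rewrite xi; have h (t : R) : 0 <= 1 + t * x.
    have [c [f [c0 _ /(_ i i)]]] := ent t.
    rewrite eqxx (negbTE ij) /= mulr0 addr0 mulcj xi -!rmorphM.
    rewrite -(rmorph1 emb) -rmorphD => /emb_inj ->.
    by rewrite mulr_ge0 ?nrm2_ge0 // ltW.
  have [->|x0] := eqVneq (x) 0; first by rewrite rmorph0.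
  by exfalso; have := h (- 2 / x); rewrite divfK //; lra.
have Xjj : X' j j = 0.
  move: (X'r j); move: (re _) => x xi; rewrite xi; have h (t : R) : 0 <= t ^+ 2 + t * x.
    have [c [f [c0 _ /(_ j j)]]] := ent t.
    rewrite eqxx (negbTE ji) /= mulr1 add0r mulcj xi -!rmorphM.
    rewrite -rmorphD => /emb_inj ->.
    by rewrite mulr_ge0 ?nrm2_ge0 // ltW.
  have [->|x0] := eqVneq (x) 0; first by rewrite rmorph0.
  exfalso; have := h (- x / 2).
  have : 0 < x ^+ 2 by rewrite lt_def sqrf_eq0 x0 sqr_ge0.
  by nra.
have [c [f [c0 f0 e]]] := ent 1.
have X'0 p q : (p != i) && (p != j) -> X' p q = 0.
  case/andP=> pi pj; have := e p q.
  by rewrite (negbTE pi) (negbTE pj) f0 //= mul0r !mulr0 rmorph1 mul1r !add0r.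
have X'0' p q : (q != i) && (q != j) -> X' p q = 0.
  by move=> h; rewrite -hX' ctE X'0 // rmorph0.
have eb : X' i j = emb c * (f i 0 * cj (f j 0)).
  by have := e i j; rewrite eqxx (negbTE ij) (negbTE ji) /= mulr0 rmorph1 mul1r !add0r.
have ei : emb c * (f i 0 * cj (f i 0)) = 1.
  by have := e i i; rewrite Xii eqxx (negbTE ij) /= !mulr0 !addr0.
have ej : emb c * (f j 0 * cj (f j 0)) = 1.
  by have := e j j; rewrite Xjj eqxx (negbTE ji) /= mulr0 addr0 add0r expr1n rmorph1 mulr1.
exists (X' i j).
  rewrite eb !rmorphM cjK cj_emb -[RHS]mulr1 -{1}ei -ej; ring.
have eX : X - X' = (X l0 l0)%:M by rewrite /X' subKr.
have -> : h2 i j (X' i j) = X'.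
  clearbody X'.
  apply/matrixP => p q; rewrite /h2 !mxE.
  have [pi|pi] := eqVneq p i; have [pj|pj] := eqVneq p j.
  - by move: ij; rewrite -pi -pj eqxx.
  - have [qj|qj] := eqVneq q j; have [qi|qi] := eqVneq q i.
    + by move: ij; rewrite -qi -qj eqxx.
    + by rewrite pi qj /= mulr1 mulr0 addr0.
    + by rewrite pi qi /= !mulr0 addr0 Xii.
    + by rewrite /= !mulr0 addr0 X'0' // qi.
  - have [qj|qj] := eqVneq q j; have [qi|qi] := eqVneq q i.
    + by move: ij; rewrite -qi -qj eqxx.
    + by rewrite pj qj /= !mulr0 addr0 Xjj.
    + by rewrite pj qi /= mulr0 mulr1 add0r -[in RHS]hX' ctE.
    + by rewrite /= !mulr0 addr0 X'0' // qi.
  - by rewrite /= !mulr0 addr0 X'0 // pi.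
rewrite eX Xr; exact: isR1.
Qed.

End Wigner.

(** * Wigner's theorem: phases and the field automorphism *)

Section WignerTheorem.
Variable n : nat.
Hypothesis n_gt2 : (2 < n)%N.
Implicit Types (f y z v w : 'cV[F]_n) (A B G H U X : 'M[F]_n) (rho : 'M[F]_n -> 'M[F]_n).
Local Notation e_ i := (delta_mx i 0 : 'cV[F]_n).
Local Notation E_ i := (delta_mx i i : 'M[F]_n).

(** A relation, since [pair_image] yields b only for unimodular a; real-linearity reaches the other
    coefficients. *)
Definition pair_rel rho i j a b := isR (rho (h2 i j a) - h2 i j b).

Lemma pair_rel_lin rho i j s a b a' b' : whyp rho ->
  pair_rel rho i j a b -> pair_rel rho i j a' b' ->
  pair_rel rho i j (emb s * a + a') (emb s * b + b').
Proof.
case=> r_lin _ _ _ _ h h'; have := isRD (isRZ s h) h'; rewrite /pair_rel.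
rewrite !h2_lin r_lin; move: (rho _) (rho _) (h2 i j b) (h2 i j b') => X1 X2 X3 X4.
by congr isR; apply/matrixP => p q; rewrite !mxE; ring.
Qed.

Lemma pair_rel_sym rho i j a b : pair_rel rho i j a b ->
  pair_rel rho j i (cj a) (cj b).
Proof. by rewrite /pair_rel !h2_sym. Qed.

Lemma pair_rel_inj rho i j a b b' : i != j ->
  pair_rel rho i j a b -> pair_rel rho i j a b' -> b = b'.
Proof.
move=> ij h h'; apply/esym/(h2_inj ij); have := isRB h h'.
by rewrite opprB addrC addrA subrK.
Qed.

Lemma pair_rel_unit rho i j a b : whyp rho -> diag_normal rho -> i != j ->
  a * cj a = 1 -> pair_rel rho i j a b -> b * cj b = 1.
Proof.
move=> hw hd ij a1 hb; have [b' b1 hb'] := pair_image n_gt2 hw hd ij a1.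
by rewrite (pair_rel_inj ij hb hb').
Qed.

(** Conjugation by a diagonal unitary keeps the diagonal normalization and can turn the unimodular
    coefficients of all pairs (i0, j) into 1. *)
Lemma whyp_normal rho : whyp rho -> exists c U i0,
  [/\ 0 < c, unitary U, whyp (conjm c U rho), diag_normal (conjm c U rho) &
      forall j, j != i0 -> pair_rel (conjm c U rho) i0 j 1 1].
Proof.
move=> hw; have [c [U [c0 hU hd]]] := whyp_diag n_gt2 hw.
have hw1 := whyp_conj hU c0 hw; set r1 := conjm c U rho in hd hw1.
have i0 : 'I_n := Ordinal (ltn_trans (ltn0Sn 1) n_gt2).
have /choice[b hb] : forall j, exists b, b * cj b = 1 /\ (j != i0 -> pair_rel r1 i0 j 1 b).
  move=> j; have [->|ji] := eqVneq j i0; first by exists 1; rewrite rmorph1 mulr1.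
  have [||b b1 h] := pair_image n_gt2 hw1 hd (_ : i0 != j) (a := 1).
  - by rewrite eq_sym.
  - by rewrite rmorph1 mulr1.
  by exists b.
pose d j := if j == i0 then 1 else cj (b j).
have d1 j : d j * cj (d j) = 1.
  rewrite /d; case: eqP => _; first by rewrite rmorph1 mulr1.
  by rewrite cjK mulrC; have [] := hb j.
pose D : 'M[F]_n := diag_mx (\row_j d j).
have ctD' : ct D = diag_mx (\row_j cj (d j)).
  apply/matrixP => p q; rewrite ctE !mxE eq_sym.
  by case: eqP => [->|_]; rewrite ?mulr1n ?mulr0n ?rmorph0.
have conjD (M : 'M[F]_n) p q : (ct D *m M *m D) p q = cj (d p) * M p q * d q.
  by rewrite ctD' mul_mx_diag mxE mul_diag_mx !mxE.
have hD : unitary D.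
  rewrite /unitary -[ct D]mulmx1; apply/matrixP => p q; rewrite conjD !mxE.
  case: eqP => [->|_]; last by rewrite !mulr0n mulr0 mul0r.
  by rewrite !mulr1n mulr1 mulrC d1.
have hUD := unitaryM hU hD.
have e H : conjm c (U *m D) rho H = emb 1 *: (ct D *m r1 H *m D).
  rewrite /r1 /conjm rmorph1 scale1r -scalemxAr -scalemxAl ctM.
  by rewrite !mulmxA.
exists c, (U *m D), i0; split=> //.
- exact: whyp_conj.
- move=> j; rewrite e; have := isR_conj 1 hD (hd j).
  rewrite mulmxBr mulmxBl scalerBr; congr (isR (_ - _)).
  rewrite rmorph1 scale1r; apply/matrixP => p q; rewrite conjD !mxE.
  have [->|] := eqVneq p j; have [->|] := eqVneq q j; rewrite ?mulr0 ?mul0r //.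
  by rewrite mulr1 mulrC d1.
move=> j ji; rewrite /pair_rel e; have [b1 /(_ ji) hbj] := hb j.
have := isR_conj 1 hD hbj.
rewrite mulmxBr mulmxBl scalerBr; congr (isR (_ - _)).
rewrite rmorph1 scale1r; apply/matrixP => p q; rewrite conjD !mxE rmorph1 !mul1r.
have di0 : d i0 = 1 by rewrite /d eqxx.
have dj : d j = cj (b j) by rewrite /d (negbTE ji).
have [->|pi] := eqVneq p i0; have [->|qj] := eqVneq q j; rewrite ?eqxx ?(negbTE ji) /=.
- by rewrite di0 dj rmorph1 (eq_sym i0) (negbTE ji) /= mulr0 addr0 mulr1 mul1r b1 addr0.
- by rewrite (eq_sym i0) (negbTE ji) !(mulr0, addr0, mul0r).
- by rewrite andbF !(mulr0, addr0, mul0r).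
have [->|pj] := eqVneq p j; have [->|qi] := eqVneq q i0; rewrite /= ?mulr0 ?add0r ?mulr0 ?mul0r //.
by rewrite di0 dj cjK !mulr1 b1.
Qed.

(** For the image f of e_i0 + x e_i + z e_j, rank one yields the cocycle relation (f_i conj
    f_i0)(f_i0 conj f_j) = |f_i0|^2 f_i conj f_j. *)
Lemma pair_rel_triple rho i0 i j (x z : F) b1 b2 b3 : whyp rho -> diag_normal rho ->
  i0 != i -> i0 != j -> i != j -> x * cj x = 1 -> z * cj z = 1 ->
  pair_rel rho i0 i (cj x) b1 -> pair_rel rho i0 j (cj z) b2 ->
  pair_rel rho i j (x * cj z) b3 -> b3 = cj b1 * b2.
Proof.
move=> hw hd oi oj ij x1 z1 h1 h2' h3; case: (hw) => r_lin r_h r_1 r_ex r_o.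
have b11 : b1 * cj b1 = 1.
  by apply: (pair_rel_unit hw hd oi _ h1); rewrite cjK mulrC.
pose y : 'cV[F]_n := e_ i0 + x *: e_ i + z *: e_ j.
have y0 : y != 0.
  apply/eqP => /colP/(_ i0)/eqP.
  by rewrite !mxE !eqxx (negbTE oi) (negbTE oj) !mulr0 !addr0 oner_eq0.
have [f [_ [c c0 hc]]] := r_ex _ y0.
have ey : oproj y y = E_ i0 + E_ i + E_ j + h2 i0 i (cj x) + h2 i0 j (cj z)
    + h2 i j (x * cj z).
  rewrite /y !(oprojDl, oprojDr, oprojZl, oprojZr) !oproj_delta /h2.
  rewrite !rmorphM !cjK; apply/matrixP => p q; rewrite !mxE.
  have -> : x * (cj x * ((p == i) && (q == i))%:R) = ((p == i) && (q == i))%:R.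
    by rewrite mulrA x1 mul1r.
  have -> : z * (cj z * ((p == j) && (q == j))%:R) = ((p == j) && (q == j))%:R.
    by rewrite mulrA z1 mul1r.
  ring.
have [r hr] : isR (E_ i0 + E_ i + E_ j + h2 i0 i b1 + h2 i0 j b2 + h2 i j b3
     - emb c *: oproj f f).
  have h := isRB (isRB (isRB (isRB (isRB (isRB hc (hd i0)) (hd i)) (hd j)) h1) h2') h3.
  move: h; rewrite ey 5!(rlinD r_lin).
  move: (rho (E_ i0)) (rho (E_ i)) (rho (E_ j)) (rho (h2 i0 i _)) (rho (h2 i0 j _))
     (rho (h2 i j _)) (oproj f f) (h2 i0 i b1) (h2 i0 j b2) (h2 i j b3).
  move=> r0 r1 r2 r3 r4 r5 O x3 x4 x5; congr isR.
  by apply/matrixP => p q; rewrite !mxE; ring.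
have ent p q : (E_ i0 + E_ i + E_ j + h2 i0 i b1 + h2 i0 j b2 + h2 i j b3) p q =
    emb c * (f p 0 * cj (f q 0)) + emb r *+ (p == q).
  move/eqP: hr; rewrite subr_eq => /eqP ->.
  by rewrite mxE [X in _ + X]mxE oproj_entry [X in X + _]mxE addrC.
have io : i != i0 by rewrite eq_sym.
have jo : j != i0 by rewrite eq_sym.
have ji : j != i by rewrite eq_sym.
have e00 := ent i0 i0; have eii := ent i i; have e0i := ent i0 i.
have e0j := ent i0 j; have eij := ent i j.
move: e00 eii e0i e0j eij; rewrite !mxE !eqxx !(negbTE oi, negbTE oj, negbTE ij, negbTE io, negbTE jo, negbTE ji).
rewrite /= !(mulr0, mulr1, addr0, add0r, mulr0n, mulr1n) => e00 eii e0i e0j eij.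
move: e00 eii; rewrite !mulcj -!rmorphM -!rmorphD -(rmorph1 emb) => /emb_inj e00 /emb_inj eii.
(* Both diagonal entries are 1 and contain the same unknown r, so c|f_i0|^2 = c|f_i|^2; the product
   is |b1|^2 = 1, hence each is 1. *)
have n1 : (c * nrm2 (f i0 0)) * (c * nrm2 (f i 0)) = 1.
  apply: (emb_inj); rewrite !rmorphM -!mulcj rmorph1 -b11 e0i !rmorphM cjK cj_emb.
  ring.
have p0 : 0 <= c * nrm2 (f i0 0) by rewrite mulr_ge0 ?nrm2_ge0 // ltW.
have n0 : c * nrm2 (f i0 0) = 1.
  have e : c * nrm2 (f i 0) = c * nrm2 (f i0 0) by lra.
  rewrite e in n1; move: p0 n1; move: (_ * _) => t; nra.
rewrite eij e0i e0j !rmorphM cjK cj_emb.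
have -> : emb c * (cj (f i0 0) * f i 0) * (emb c * (f i0 0 * cj (f j 0))) =
   (emb c * (f i0 0 * cj (f i0 0))) * (emb c * (f i 0 * cj (f j 0))) by ring.
by rewrite mulcj -rmorphM n0 rmorph1 mul1r.
Qed.

(* If a |-> b is the map on the coefficients of the pair (i0, j), it fixes 1 and
   preserves unit modulus at i and at (3 + 4i)/5, so it is the identity or the
   conjugation; the triples (i0, i, j) make it independent of j. *)
Lemma pair_rel_sigma rho i0 : whyp rho -> diag_normal rho ->
  (forall j, j != i0 -> pair_rel rho i0 j 1 1) ->
  exists2 s : {rmorphism F -> F}, (s =1 id \/ s =1 cj) &
    forall i j a, i != j -> pair_rel rho i j a (s a).
Proof.
move=> hw hd h1.
have one1 : (1 : F) * cj 1 = 1 by rewrite rmorph1 mulr1.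
have hij1 i j : i != j -> pair_rel rho i j 1 1.
  move=> ij; have [io|io] := eqVneq i i0; first by rewrite io; apply: h1; rewrite -io eq_sym.
  have [jo|jo] := eqVneq j i0.
    by have := pair_rel_sym (h1 i io); rewrite !rmorph1 jo.
  have [b b1 hb] := pair_image n_gt2 hw hd ij one1.
  have : b = cj 1 * 1.
    have oi : i0 != i by rewrite eq_sym.
    have oj : i0 != j by rewrite eq_sym.
    apply: (pair_rel_triple (x := 1) (z := 1) hw hd oi oj ij one1 one1).
    - by rewrite rmorph1; apply: h1.
    - by rewrite rmorph1; apply: h1.
    - by rewrite rmorph1 mulr1.
  by rewrite rmorph1 mulr1 => e; rewrite e in hb.
have r0 i j : pair_rel rho i j 0 0.
  rewrite /pair_rel /h2 rmorph0 !scale0r addr0; case: hw => r_lin _ _ _ _.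
  by rewrite (rlin0 r_lin) subr0; apply: isR0.
have [cid|[u [uu cu gen]]] := cj_cases S.
  exists idfun; first by left.
  move=> i j a ij; have := pair_rel_lin (re a) hw (hij1 _ _ ij) (r0 i j).
  by rewrite !mulr1 !addr0 -(cj_real (cid a)).
have u1 : u * cj u = 1 by rewrite cu mulrN uu opprK.
have reu : re u = 0.
  by have := reD u (cj u); rewrite re_cj cu subrr re0; lra.
have pm j l : j != i0 -> pair_rel rho i0 j u l -> l = u \/ l = - u.
  move=> jo hl; have oj : i0 != j by rewrite eq_sym.
  have l1 := pair_rel_unit hw hd oj u1 hl.
  have [x [y el]] := gen l.
  have rel : re l = x by rewrite el reD re_embM reu mulr0 addr0 re_emb.
  have cl : cj l = emb x - emb y * u by rewrite el rmorphD rmorphM !cj_emb cu mulrN.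
  have xy : x ^+ 2 + y ^+ 2 = 1.
    apply: (emb_inj); rewrite rmorph1 -l1 cl el rmorphD !rmorphXn /=.
    have -> : (emb x + emb y * u) * (emb x - emb y * u) = emb x ^+ 2 - emb y ^+ 2 * (u * u) by ring.
    by rewrite uu; ring.
  have h35 := pair_rel_lin (3 / 5) hw (hij1 _ _ oj) (pair_rel_lin (4 / 5) hw hl (r0 i0 j)).
  rewrite !addr0 !mulr1 in h35.
  have e1 : (3 / 5 : R) ^+ 2 + (4 / 5) ^+ 2 = 1 by field.
  have := pair_rel_unit hw hd oj _ h35.
  have -> : (emb (3 / 5) + emb (4 / 5) * u) * cj (emb (3 / 5) + emb (4 / 5) * u) = 1.
    have e2 : emb (3 / 5) ^+ 2 + emb (4 / 5) ^+ 2 = 1.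
      by rewrite -!rmorphXn -rmorphD e1 rmorph1.
    rewrite rmorphD rmorphM !cj_emb cu.
    have -> t s : (t + s * u) * (t + s * - u) = t ^+ 2 - s ^+ 2 * (u * u) by ring.
    by rewrite uu mulrN1 opprK.
  move=> /(_ erefl); rewrite rmorphD rmorphM !cj_emb cl el.
  have -> t s : (t + s * (emb x + emb y * u)) * (t + s * (emb x - emb y * u)) =
    t ^+ 2 + s ^+ 2 * (emb x ^+ 2 - emb y ^+ 2 * (u * u)) + 2%:R * (t * s * emb x) by ring.
  rewrite uu mulrN1 opprK -[2%:R]emb_nat -!rmorphXn -!rmorphM -!rmorphD -!rmorphM -!rmorphD -(rmorph1 emb).
  move=> /emb_inj h; have x0 : x = 0.
    move: h; rewrite xy; lra.
  have y1 : (y - 1) * (y + 1) = 0 by move: xy; rewrite x0; lra.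
  move/eqP: y1; rewrite mulf_eq0 subr_eq0 addr_eq0 x0 rmorph0 add0r.
  case/orP => /eqP ->; first by left; rewrite rmorph1 mul1r.
  by right; rewrite rmorphN1 mulN1r.
have [j0 /andP[jo _]] := third n_gt2 i0 i0.
have oj0 : i0 != j0 by rewrite eq_sym.
have [l l1 hl] := pair_image n_gt2 hw hd oj0 u1.
have lpm := pm _ _ jo hl.
have cll : cj (- l) = l by case: lpm => ->; rewrite rmorphN ?rmorphN cu ?opprK.
have cul : cj u = - u := cu.
(* The coefficient u at (i, j) is x cj z both for (x, z) = (1, -u) and for (u, 1); its image is
   therefore lj and also li. *)
have key i j : i != i0 -> j != i0 -> i != j -> forall li lj,
    pair_rel rho i0 i u li -> pair_rel rho i0 j u lj ->
    li = lj /\ pair_rel rho i j u lj.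
  move=> io jo' ij li lj hi hj; have oi : i0 != i by rewrite eq_sym.
  have oj : i0 != j by rewrite eq_sym.
  have [b b1 hb] := pair_image n_gt2 hw hd ij u1.
  have e1 : b = cj 1 * lj.
    apply: (pair_rel_triple (x := 1) (z := - u) hw hd oi oj ij one1).
    - by rewrite rmorphN cu mulrNN -cu.
    - by rewrite rmorph1; apply: h1.
    - by rewrite rmorphN cu opprK.
    - by rewrite rmorphN cu opprK mul1r.
  have e2 : b = cj (- li) * 1.
    apply: (pair_rel_triple (x := u) (z := 1) hw hd oi oj ij u1 one1).
    - rewrite cu; have := pair_rel_lin (-1) hw hi (r0 i0 i).
      by rewrite !addr0 rmorphN1 !mulN1r.
    - by rewrite rmorph1; apply: h1.
    - by rewrite rmorph1 mulr1.
  rewrite rmorph1 mul1r in e1; rewrite mulr1 in e2.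
  have e3 : cj (- li) = li by case: (pm _ _ io hi) => ->; rewrite rmorphN ?rmorphN cu ?opprK.
  by split; [rewrite -e3 -e2 e1 | rewrite -e1].
have hall i j : i != j -> pair_rel rho i j u l.
  have h0 j' : j' != i0 -> pair_rel rho i0 j' u l.
    move=> jo'; have [->//|jj] := eqVneq j' j0.
    have [|b b1 hb] := pair_image n_gt2 hw hd (_ : i0 != j') u1; first by rewrite eq_sym.
    by have [<- _] := key _ _ jo' jo jj _ _ hb hl.
  move=> ij; have [io|io] := eqVneq i i0; first by rewrite io; apply: h0; rewrite -io eq_sym.
  have [jo'|jo'] := eqVneq j i0.
    have := pair_rel_sym (h0 i io); rewrite jo' cu => h.
    have := pair_rel_lin (-1) hw h (r0 i i0); rewrite !addr0 rmorphN1 !mulN1r opprK.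
    by rewrite -rmorphN cll.
  by have [_] := key _ _ io jo' ij _ _ (h0 _ io) (h0 _ jo').
have fin (s : {rmorphism F -> F}) : (forall a, s (emb a) = emb a) -> s u = l ->
    forall i j a, i != j -> pair_rel rho i j a (s a).
  move=> se su i j a ij; have [x [y ->]] := gen a.
  rewrite rmorphD rmorphM !se su.
  have := pair_rel_lin x hw (hij1 _ _ ij) (pair_rel_lin y hw (hall _ _ ij) (r0 i j)).
  by rewrite !mulr1 !addr0.
case: lpm => el.
  by exists idfun; [left | apply: fin; rewrite // el].
by exists cj; [right | apply: fin; [exact: cj_emb | rewrite el]].
Qed.

End WignerTheorem.

(** * Wigner's theorem applied to the inverse of k *)

Section DirectionMap.
Variable n : nat.
Hypothesis n_gt2 : (2 < n)%N.
Implicit Types (f y z v w : 'cV[F]_n) (A B G H U X : 'M[F]_n).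

Definition conj_or_id (s : F -> F) := s =1 id \/ s =1 cj.

Section ConjOrId.
Variable s : {rmorphism F -> F}.
Hypothesis hs : conj_or_id s.

Lemma coi_emb a : s (emb a) = emb a.
Proof. by case: hs => ->; rewrite ?cj_emb. Qed.
Lemma coi_cj x : s (cj x) = cj (s x).
Proof. by case: hs => e; rewrite !e. Qed.
Lemma coiK : involutive s.
Proof. by move=> x; case: hs => e; rewrite !e ?cjK. Qed.
Lemma coi_nrm2 x : nrm2 (s x) = nrm2 x.
Proof. by case: hs => ->; rewrite ?nrm2_cj. Qed.
Lemma coi_mxK m p : involutive (@map_mx F F s m p).
Proof. by move=> A; apply/matrixP => i j; rewrite !mxE coiK. Qed.
Lemma coi_ct m p (A : 'M[F]_(m, p)) : map_mx s (ct A) = ct (map_mx s A).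
Proof. by apply/matrixP => i j; rewrite !mxE coi_cj. Qed.
Lemma coi_oproj f y : map_mx s (oproj f y) = oproj (map_mx s f) (map_mx s y).
Proof. by rewrite /oproj map_mxM coi_ct. Qed.
Lemma coi_nq y : nq (map_mx s y) = nq y.
Proof. by apply: eq_bigr => i _; rewrite mxE coi_nrm2. Qed.
Lemma coi_unitary U : unitary U -> unitary (map_mx s U).
Proof. by move=> hU; rewrite /unitary -coi_ct -map_mxM hU map_mx1. Qed.
Lemma coi_rlin a A B :
  map_mx s (emb a *: A + B) = emb a *: map_mx s A + map_mx s B.
Proof. by rewrite map_mxD map_mxZ coi_emb. Qed.
End ConjOrId.

(** Real-linearity reduces the claim to diagonal units and to the pairs h2 with i != j. *)
Lemma wigner (rho : 'M[F]_n -> 'M[F]_n) : whyp rho ->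
  exists c U (s : {rmorphism F -> F}), [/\ 0 < c, unitary U, conj_or_id s &
    forall H, ct H = H -> isR (conjm c U rho H - map_mx s H)].
Proof.
move=> hw; have [c [U [i0 [c0 hU hw' hd h1]]]] := whyp_normal n_gt2 hw.
have [s hs hp] := pair_rel_sigma n_gt2 hw' hd h1.
exists c, U, s; split=> //; set r := conjm c U rho in hw' hd h1 hp *.
case: (hw') => r_lin _ _ _ _.
pose P H := isR (r H - map_mx s H).
have PD A B : P A -> P B -> P (A + B).
  move=> hA hB; have := isRD hA hB; rewrite /P (rlinD r_lin) map_mxD.
  by rewrite opprD addrACA.
have PZ a A : P A -> P (emb a *: A).
  move=> hA; have := isRZ a hA; rewrite /P (rlinZ r_lin) map_mxZ (coi_emb hs).
  by rewrite scalerBr.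
have P0 : P 0 by rewrite /P (rlin0 r_lin) map_mx0 subr0; apply: isR0.
have sh2 i j a : map_mx s (h2 i j a) = h2 i j (s a).
  by rewrite /h2 map_mxD !map_mxZ !map_delta_mx (coi_cj hs).
move=> H hH; rewrite -/(P H) -[H]half_scale -{2}hH add_ct; apply: PZ.
elim/big_ind: _ => // i _; elim/big_ind: _ => // j _.
have [->|ij] := eqVneq i j; last by rewrite /P sh2; apply: hp.
have -> : h2 j j (H j j) = emb (re (H j j) *+ 2) *: delta_mx j j.
  by rewrite /h2 -scalerDl addcj.
rewrite /P (rlinZ r_lin) map_mxZ (coi_emb hs) map_delta_mx -scalerBr.
exact: isRZ (hd j).
Qed.

Variable k : 'M[F]_n -> 'M[F]_n.
Hypothesis k_lin : forall a A B, k (emb a *: A + B) = emb a *: k A + k B.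
Hypothesis ct_k : forall Z, ct (k Z) = k Z.
Hypothesis k_1 : isR (k 1%:M).
Hypothesis k_surj : forall H, ct H = H -> exists2 K, ct K = K & k K = H.
Hypothesis k_inj : forall K, ct K = K -> isR (k K) -> isR K.
Hypothesis k_inj0 : forall K, ct K = K -> k K = 0 -> K = 0.
Hypothesis dirn_ex : forall y', y' != 0 -> exists y, dirn k y' y.

Definition hpart (Z : 'M[F]_n) := emb 2^-1 *: (Z + ct Z).

Lemma ct_hpart Z : ct (hpart Z) = hpart Z.
Proof. by rewrite /hpart ctZ cj_emb ctD ctK addrC. Qed.
Lemma hpart_herm H : ct H = H -> hpart H = H.
Proof. by move=> hH; rewrite /hpart hH half_scale. Qed.

(** [dirn_ex] provides a y for each y', so the map fit for Wigner's theorem goes from y' to y: it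
    inverts k on Hermitian matrices and is extended to all matrices through [hpart]. *)
Lemma whyp_inverse : exists2 rho, whyp rho &
  forall y' y, dirn k y' y -> rank1_rel rho y' y.
Proof.
have /choice[rho hr] : forall Z, exists K, ct K = K /\ k K = hpart Z.
  by move=> Z; have [K hK kK] := k_surj (ct_hpart Z); exists K.
have uniq K K' : ct K = K -> ct K' = K' -> k K = k K' -> K = K'.
  move=> hK hK' e; apply/eqP; rewrite -subr_eq0; apply/eqP/k_inj0.
    by rewrite ctB hK hK'.
  by rewrite (rlinB k_lin) e subrr.
have r_ct Z : ct (rho Z) = rho Z by have [] := hr Z.
have kr Z : k (rho Z) = hpart Z by have [] := hr Z.
have r_lin a A B : rho (emb a *: A + B) = emb a *: rho A + rho B.
  apply: uniq => //; first by rewrite ctD ctZ cj_emb !r_ct.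
  rewrite k_lin !kr /hpart ctD ctZ cj_emb.
  by apply/matrixP => i j; rewrite !mxE; ring.
have r1 : isR (rho 1%:M).
  by apply: k_inj => //; rewrite kr hpart_herm ?ct1 //; exists 1; rewrite rmorph1.
have rk K : ct K = K -> rho (k K) = K.
  by move=> hK; apply: uniq => //; rewrite kr hpart_herm.
have dirn_rank1_rel y' y : dirn k y' y -> rank1_rel rho y' y.
  move=> d; case: (d) => y'0 y0 _; split=> //.
  have [m m0 [r hm]] := dirn_rank1 n_gt2 k_lin ct_k k_1 k_surj k_inj dirn_ex d.
  exists m^-1; first by rewrite invr_gt0.
  have e : oproj y y = emb m *: rho (oproj y' y') + emb r *: rho 1%:M.
    rewrite -(rlinZ r_lin r) -r_lin -[LHS]rk ?ct_oproj //; congr rho.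
    rewrite scale_scalar_mx mulr1 -hm addrC subrK.
    by [].
  rewrite e scalerDr scalerA -rmorphM mulVf ?gt_eqF // rmorph1 scale1r.
  by rewrite opprD addrA subrr sub0r; apply: isRN; apply: isRZ; apply: isRZ.
exists rho => //; split=> //.
  by move=> y /dirn_ex[f /dirn_rank1_rel]; exists f.
move=> y1 y2 f1 f2 h1 h2' o.
have nz y f : rank1_rel rho y f -> y != 0.
  case=> f0 [c c0 hc]; apply/eqP => y0; rewrite y0 in hc.
  have [|d fd] := oproj_line (b := 1) (y := 0) n_gt2 c0 f0; last first.
    by move: f0; rewrite fd scaler0 eqxx.
  move: hc; rewrite /oproj mul0mx (rlin0 r_lin) sub0r => /isRN.
  by rewrite opprK scaler0 subr0.
have line y f g : rank1_rel rho y f -> rank1_rel rho y g -> exists d, f = d *: g.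
  case=> f0 [a a0 ha] [g0 [b b0 hb]].
  apply: (oproj_line (a := a) (b := b) n_gt2 a0 f0).
  by have := isRB hb ha; rewrite opprB addrC addrA subrK.
have [g1 d1] := dirn_ex (nz _ _ h1); have [g2 d2] := dirn_ex (nz _ _ h2').
have og := dirn_orth k_lin ct_k k_1 k_surj d1 d2 o.
have [c1 ->] := line _ _ _ h1 (dirn_rank1_rel _ _ d1).
have [c2 ->] := line _ _ _ h2' (dirn_rank1_rel _ _ d2).
by rewrite dotZl dotZr og !mulr0.
Qed.

Theorem direction_map : exists U (s : {rmorphism F -> F}),
  [/\ unitary U, conj_or_id s &
      forall y' y, dirn k y' y -> exists d, y = d *: (U *m map_mx s y')].
Proof.
have [rho hw hf] := whyp_inverse.
have [c [U [s [c0 hU hs hH]]]] := wigner hw.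
exists U, s; split=> // y' y d; case: (d) => y'0 y0 _.
have := conjm_rank1_rel hU c0 (hf _ _ d); case=> f0 [a a0 ha].
have := hH _ (ct_oproj y' y'); rewrite (coi_oproj hs) => h.
have [|e he] := oproj_line (b := 1) (y := map_mx s y') n_gt2 a0 f0.
  by have := isRB h ha; rewrite rmorph1 scale1r opprB addrC addrA subrK.
exists e; rewrite scalemxAr -he mulmxA unitaryC // mul1mx.
by [].
Qed.
End DirectionMap.

(** * Preservers of norm products *)

Section Preservers.
Variable n : nat.
Hypothesis n_gt2 : (2 < n)%N.
Implicit Types (x y z v w : 'cV[F]_n) (A B H K Q U V : 'M[F]_n) (T : 'M[F]_n -> 'M[F]_n).

Let n_gt0 : (0 < n)%N := ltn_trans (ltn0Sn 1) n_gt2.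

Definition linear_bij T :=
  [/\ forall a A B, T (emb a *: A + B) = emb a *: T A + T B,
      forall B, exists A, T A = B & forall A, T A = 0 -> A = 0].

Definition preserver T := linear_bij T /\ forall A B,
  N2 (A *m B) = N2 A * N2 B -> N2 (T A *m T B) = N2 (T A) * N2 (T B).

Lemma linear_bij_inj T A B : linear_bij T -> T A = T B -> A = B.
Proof.
case=> T_lin _ T_inj e; apply/eqP; rewrite -subr_eq0; apply/eqP/T_inj.
by rewrite (rlinB T_lin) e subrr.
Qed.

Lemma unitary_isL U y : unitary U -> isL U y.
Proof.
by move=> hU x; rewrite !(unitary_nq _ (unitary_ct hU)) mulrC.
Qed.

Lemma nonzero_vec : exists x, x != 0.
Proof. by have [w w0 _] := orth_pair (0 : 'cV_n) 0 n_gt2; exists w. Qed.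

(** U^* attains its norm in every direction, so norms multiply for A and U whatever A is; with T(A)
    = xy^* this says |T(U)^*y| = ||T(U)|| |y|. *)
Lemma preserver_scaled_unitary T U : preserver T -> unitary U -> isR (br (T U) (T U)).
Proof.
move=> [[T_lin T_surj T_inj] hT] hU.
have [x x0] := nonzero_vec.
have e y : nq (ct (T U) *m y) = N2 (T U) * nq y.
  have [A hA] := T_surj (oproj x y).
  have [v v0 hv] := isM_exists n_gt0 A.
  have := hT _ _ (N2_mul_common n_gt0 v0 hv (unitary_isL v hU)).
  rewrite hA N2_oproj_mul // N2_oproj // -mulrA (mulrC (nq y)).
  by apply: mulfI; rewrite nq_eq0.
exists (2 * N2 (T U)); apply/eqP; rewrite -subr_eq0; apply/eqP.
apply: (herm_form_eq0); first by rewrite ctB ct_br ct_scalar cj_emb.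
by move=> y; rewrite mulmxBl rdBr rd_br mul_scalar_mx rdZr rdxx e; ring.
Qed.

(** Exchanges the two factors of a product, hence [isM] and [isL]. *)
Definition dual T A := ct (T (ct A)).

Lemma linear_bij_dual T : linear_bij T -> linear_bij (dual T).
Proof.
case=> T_lin T_surj T_inj; split.
- by move=> a A B; rewrite /dual ctD ctZ cj_emb T_lin ctD ctZ cj_emb.
- by move=> B; have [A hA] := T_surj (ct B); exists (ct A); rewrite /dual ctK hA ctK.
move=> A h; rewrite -[A]ctK [ct A]T_inj ?ct0 //.
by rewrite -[LHS]ctK -/(dual T A) h ct0.
Qed.

Lemma preserver_dual T : preserver T -> preserver (dual T).
Proof.
case=> hb hT; split; first exact: linear_bij_dual.
move=> A B e; rewrite /dual -ctM !(N2_ct n_gt0) mulrC; apply: hT.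
by rewrite -ctM !(N2_ct n_gt0) e mulrC.
Qed.

(* The first clause says that y can be any direction in which the preimage of
   x y'^* attains its norm; the second is what preservation of norm products
   gives for it. *)
Definition source T x y' y := [/\ y' != 0, y != 0,
  forall A, T A = oproj x y' -> isM A y & forall B, isL B y -> isL (T B) y'].

Lemma source_exists T x y' : preserver T -> x != 0 -> y' != 0 ->
  exists y, source T x y' y.
Proof.
move=> [hb hT] x0 y'0; case: (hb) => T_lin T_surj T_inj.
have [A hA] := T_surj (oproj x y').
have [y y0 hy] := isM_exists n_gt0 A; exists y; split=> //.
  by move=> A' hA'; rewrite (linear_bij_inj hb (etrans hA' (esym hA))).
move=> B hB; apply: N2_isM => //; rewrite N2_ct //.
have := hT _ _ (N2_mul_common n_gt0 y0 hy hB).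
rewrite hA N2_oproj_mul // N2_oproj // -mulrA (mulrC (nq y')).
by apply: mulfI; rewrite nq_eq0.
Qed.

(** * Maps sending unitaries to multiples of unitaries *)

Section ScaledUnitary.
Variable T : 'M[F]_n -> 'M[F]_n.
Hypothesis T_bij : linear_bij T.
Hypothesis T_su : forall U, unitary U -> isR (br (T U) (T U)).

Let T_lin : forall a A B, T (emb a *: A + B) = emb a *: T A + T B.
Proof. by case: T_bij. Qed.
Let T_surj : forall B, exists A, T A = B.
Proof. by case: T_bij. Qed.
Let T_inj : forall A, T A = 0 -> A = 0.
Proof. by case: T_bij. Qed.
Let k := kmap T.

Let k_lin := kmap_lin T_lin.
Let ct_k := ct_kmap T.
Let k_surj := kmap_surj n_gt0 T_lin T_surj T_inj T_su.
Let k_inj := kmap_inj n_gt0 T_lin T_surj T_inj T_su.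
Let k_inj0 := kmap_inj0 n_gt0 T_lin T_surj T_inj T_su.
Lemma k_1 : isR (k 1%:M).
Proof. by have [r _ [hr _]] := kmap1 n_gt0 T_inj T_su; exists r. Qed.

Lemma source_dirn y' y : y' != 0 -> y != 0 ->
  (forall B, isL B y -> isL (T B) y') -> dirn k y' y.
Proof.
move=> y'0 y0 h; split=> // z zy.
exact: (kmap_isMin T_lin T_su zy h).
Qed.

Lemma su_direction_map :
  (forall y', y' != 0 -> exists2 y, y != 0 & forall B, isL B y -> isL (T B) y') ->
  exists U (s : {rmorphism F -> F}), [/\ unitary U, conj_or_id s &
   forall y' y, y' != 0 -> y != 0 -> (forall B, isL B y -> isL (T B) y') ->
     exists d, y = d *: (U *m map_mx s y')].
Proof.
move=> hex; have [|U [s [hU hs h]]] :=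
  direction_map n_gt2 k_lin ct_k k_1 k_surj k_inj k_inj0.
  by move=> y' y'0; have [y y0 hy] := hex _ y'0; exists y; apply: source_dirn.
exists U, s; split=> // y' y y'0 y0 hy; apply: h; exact: source_dirn.
Qed.

Lemma su_rank1 z : (forall y B, y != 0 -> isL B y -> isL (T B) y) -> z != 0 ->
  exists2 m, 0 < m & isR (br (T (oproj z z)) (T 1%:M) - emb m *: oproj z z).
Proof.
move=> h z0.
have d y : y != 0 -> dirn k y y.
  by move=> y0; apply: source_dirn => // B; apply: h.
apply: (dirn_rank1 n_gt2 k_lin ct_k k_1 k_surj k_inj _ (d z z0)).
by move=> y y0; exists y; apply: d.
Qed.
End ScaledUnitary.

(** A |-> T(AU) still sends unitaries to multiples of unitaries, and (AU)^* attains its norm exactly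
    where A^* does; [su_rank1] asks no more. *)
Lemma fixed_rank1 T U z : preserver T ->
  (forall y B, y != 0 -> isL B y -> isL (T B) y) -> unitary U -> z != 0 ->
  exists2 m, 0 < m & isR (br (T (oproj z z *m U)) (T U) - emb m *: oproj z z).
Proof.
move=> hT h hU z0; case: (hT) => -[T_lin T_surj T_inj] _.
have [|||m m0] := @su_rank1 (fun A => T (A *m U)) _ _ z _ z0.
- split.
  + by move=> a A B; rewrite mulmxDl -scalemxAl T_lin.
  + move=> B; have [A hA] := T_surj B; exists (A *m ct U).
    by rewrite -mulmxA hU mulmx1.
  + move=> A /T_inj e; rewrite -[A]mulmx1 -(unitaryC hU) mulmxA e mul0mx.
    by [].
- by move=> V hV; apply: preserver_scaled_unitary hT (unitaryM hV hU).
- move=> y B y0 hB; apply: h => // x.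
  by rewrite ctM -!mulmxA !(unitary_nq _ (unitary_ct hU)); apply: hB.
by rewrite mul1mx; exists m.
Qed.

(** * Change of coordinates A |-> U s(A) U^* *)

Definition twist U (s : F -> F) A := U *m map_mx s A *m ct U.

Section Twist.
Variables (U : 'M[F]_n) (s : {rmorphism F -> F}).
Hypotheses (hU : unitary U) (hs : conj_or_id s).
Local Notation P := (twist U s).

Lemma twist_rlin a A B : P (emb a *: A + B) = emb a *: P A + P B.
Proof. by rewrite /twist coi_rlin // mulmxDr mulmxDl -scalemxAr -scalemxAl. Qed.
Lemma twistM A B : P (A *m B) = P A *m P B.
Proof.
rewrite /twist map_mxM !mulmxA -(mulmxA _ (ct U) U) hU mulmx1.
by [].
Qed.
Lemma twist_ct A : P (ct A) = ct (P A).
Proof. by rewrite /twist !ctM ctK (coi_ct hs) mulmxA. Qed.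
Lemma twist_inv A : P (map_mx s (ct U *m A *m U)) = A.
Proof.
rewrite /twist (coi_mxK hs) !mulmxA unitaryC // mul1mx -mulmxA unitaryC // mulmx1.
by [].
Qed.
Lemma twist_nq A x : nq (P A *m x) = nq (A *m map_mx s (ct U *m x)).
Proof.
rewrite /twist -!mulmxA (unitary_nq _ hU) -(coi_nq hs) map_mxM (coi_mxK hs).
by [].
Qed.
Lemma twist_vec y : map_mx s (ct U *m (U *m map_mx s y)) = y.
Proof. by rewrite mulmxA hU mul1mx (coi_mxK hs). Qed.
Lemma twist_isM A y : isM (P A) (U *m map_mx s y) <-> isM A y.
Proof.
split=> h x.
  by have := h (U *m map_mx s x); rewrite !twist_nq !twist_vec !(unitary_nq _ hU) !(coi_nq hs).
rewrite !twist_nq twist_vec (unitary_nq _ hU) (coi_nq hs).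
have := h (map_mx s (ct U *m x)); rewrite (coi_nq hs) (unitary_nq _ (unitary_ct hU)).
exact.
Qed.
Lemma twist_N2 A : N2 (P A) = N2 A.
Proof.
have [y y0 hy] := isM_exists n_gt0 A.
have u0 : U *m map_mx s y != 0.
  by rewrite -nq_eq0 (unitary_nq _ hU) (coi_nq hs) nq_eq0.
apply: (N2_unique n_gt0 u0); first exact/twist_isM.
by rewrite twist_nq twist_vec (unitary_nq _ hU) (coi_nq hs) (isM_N2 n_gt0).
Qed.
Lemma preserver_twist T : preserver T -> preserver (fun A => T (P A)).
Proof.
move=> [[T_lin T_surj T_inj] hT]; split.
  split.
  - by move=> a A B; rewrite twist_rlin T_lin.
  - by move=> B; have [A hA] := T_surj B; exists (map_mx s (ct U *m A *m U)); rewrite twist_inv.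
  - move=> A /T_inj e; apply: (N2_eq0 n_gt0); rewrite -twist_N2 e.
    by apply: N2_0.
by move=> A B e; apply: hT; rewrite -twistM !twist_N2.
Qed.
End Twist.

(** The source of y' is a multiple of U s(y'), and norm attainment depends only on the line, so the
    twist moves it to y'. *)
Lemma preserver_normalize T : preserver T ->
  exists U (s : {rmorphism F -> F}), [/\ unitary U, conj_or_id s &
    exists2 x, x != 0 & forall y, y != 0 -> source (fun A => T (twist U s A)) x y y].
Proof.
move=> hT; have [x x0] := nonzero_vec; case: (hT) => hb _.
have [||U [s [hU hs h]]] := su_direction_map hb.
- by move=> V; apply: preserver_scaled_unitary.
- by move=> y' y'0; have [y [_ y0 _ hy]] := source_exists hT x0 y'0; exists y.
exists U, s; split=> //; exists x => // y' y'0.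
have [y [_ y0 hM hL]] := source_exists hT x0 y'0.
have [d ed] := h _ _ y'0 y0 hL.
have d0 : d != 0 by apply: contra y0 => /eqP d0; rewrite ed d0 scale0r.
have ed' : U *m map_mx s y' = d^-1 *: y by rewrite ed scalerA mulVf // scale1r.
split=> //.
  move=> A /hM hA; apply/(twist_isM hU hs); move: hA; rewrite {1}ed.
  exact: isM_scale.
move=> B /(twist_isM hU hs) hB; apply: hL; move: hB.
rewrite (twist_ct U hs) ed'; apply: isM_scale.
by rewrite invr_eq0.
Qed.

(* If A, B are the preimages of x y^* and z x^* and both attain their norm along
   y, then the norm of (x y^* )(z x^* ) is multiplicative, that is, z is parallel
   to y. *)
Lemma source_fixed_dual T x : preserver T -> x != 0 ->
  (forall y, y != 0 -> source T x y y) ->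
  forall z A, z != 0 -> isM A z -> isM (T A) z.
Proof.
move=> hT x0 hs z A z0; case: (hT) => -[T_lin T_surj T_inj] hN.
have [y [_ y0 hM hL]] := source_exists (preserver_dual hT) x0 z0.
have [B0 hB0] := T_surj (oproj z x).
have [A0 hA0] := T_surj (oproj x y).
have lB : isL B0 y by apply: hM; rewrite /dual ctK hB0 ct_oproj.
have mA : isM A0 y by case: (hs _ y0) => _ _ h _; apply: h.
have := hN _ _ (N2_mul_common n_gt0 y0 mA lB).
rewrite hA0 hB0 oproj_mull oprojE !N2_oproj // nqZ => e.
have [c hc] : exists c, z = c *: y.
  apply: (cauchy_eq y0).
  have nx : nq x * nq x != 0 by rewrite mulf_neq0 // nq_eq0.
  by apply: (mulIf nx); rewrite mulrA e; ring.
have c0 : c != 0 by apply: contra z0 => /eqP c0; rewrite hc c0 scale0r.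
move=> hA; have hAy : isM A y by move: hA; rewrite hc; apply: isM_scale.
have := hL (ct A); rewrite /isL /dual !ctK; exact.
Qed.

Lemma all_eigen_scalar A : (forall z, exists d, A *m z = d *: z) -> exists d, A = d%:M.
Proof.
move=> h; pose i0 : 'I_n := Ordinal n_gt0.
have /choice[d hd] : forall i : 'I_n, exists d, A *m delta_mx i 0 = d *: (delta_mx i 0 : 'cV_n).
  by move=> i; apply: h.
exists (d i0); apply: mulmx_ext => x.
rewrite [x]matrix_sum_delta mulmx_sumr mulmx_sumr; apply: eq_bigr => i _.
rewrite big_ord1 mul_scalar_mx -scalemxAr hd scalerA.
suff -> : d i = d i0 by rewrite scalerA mulrC.
have [->//|ii] := eqVneq i i0.
have [c hc] := h (delta_mx i 0 + delta_mx i0 0).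
rewrite mulmxDr !hd scalerDr in hc.
have e1 := congr1 (fun M : 'cV_n => M i 0) hc.
have e2 := congr1 (fun M : 'cV_n => M i0 0) hc.
rewrite !mxE !eqxx ?(eq_sym i0 i) (negbTE ii) !mulr1 !mulr0 !addr0 in e1.
by rewrite !mxE !eqxx ?(eq_sym i0 i) (negbTE ii) !mulr1 !mulr0 !add0r in e2; rewrite e1 e2.
Qed.

(* The rank-one formulas for T(.U) and for its dual are conjugate to each other
   by M = T(U); comparing them gives that Mz is parallel to Uz. *)
Lemma fixed_unitary T U : preserver T ->
  (forall y B, y != 0 -> isL B y -> isL (T B) y) ->
  (forall y A, y != 0 -> isM A y -> isM (T A) y) ->
  unitary U -> exists g, T U = g *: U.
Proof.
move=> hT hL hM hU; case: (hT) => -[T_lin T_surj T_inj] _.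
set M := T U.
have [s hs] : exists s, M *m ct M = (emb s)%:M.
  have [r hr] := preserver_scaled_unitary hT hU; exists (r / 2).
  have := half_scale (M *m ct M); rewrite -/(br M M) hr => <-.
  by rewrite scale_scalar_mx -rmorphM mulrC.
have M0 : M <> 0.
  move=> /T_inj e; have := unitaryC hU; rewrite e mul0mx => /matrixP/(_ (Ordinal n_gt0) (Ordinal n_gt0)).
  by rewrite !mxE eqxx => /esym/eqP; rewrite oner_eq0.
have s0 : s != 0.
  by apply/eqP => s0; apply: M0; apply: (mulct_eq0); rewrite hs s0 rmorph0 raddf0.
have hs' : ct M *m M = (emb s)%:M.
  have e : M *m (emb s^-1 *: ct M) = 1%:M.
    by rewrite -scalemxAr hs scale_scalar_mx -rmorphM mulVf // rmorph1.
  have := mulmx1C e; rewrite -scalemxAl => e2.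
  rewrite -[LHS]scale1r -(rmorph1 emb) -(mulfV s0) rmorphM -scalerA e2.
  by rewrite scale_scalar_mx mulr1.
have line z : z != 0 -> exists d, M *m z = d *: (U *m z).
  move=> z0; pose X := T (U *m oproj z z).
  have Uz0 : U *m z != 0 by rewrite -nq_eq0 unitary_nq // nq_eq0.
  have [m m0] := fixed_rank1 hT hL hU Uz0.
  have -> : oproj (U *m z) (U *m z) *m U = U *m oproj z z.
    by rewrite oproj_mulr mulmxA hU mul1mx oproj_mull.
  rewrite -/X -/M => h1.
  have hLd y B : y != 0 -> isL B y -> isL (dual T B) y.
    by move=> y0 hB x; rewrite /dual ctK; apply: hM.
  have [p p0] := fixed_rank1 (preserver_dual hT) hLd (unitary_ct hU) z0.
  rewrite /dual ctM !ctK ct_oproj -/X -/M => h2'.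
  have e : M *m br (ct X) (ct M) *m ct M = emb s *: br X M.
    rewrite /br !ctK mulmxDr mulmxDl !mulmxA hs -!mulmxA hs.
    by rewrite mul_scalar_mx mul_mx_scalar -scalemxAr -scalerDr addrC.
  have [r1 hr1] := h2'; have [r2 hr2] := h1.
  have Mz0 : M *m z != 0.
    apply: contra z0 => /eqP Mz; have : ct M *m (M *m z) = 0 by rewrite Mz mulmx0.
    by rewrite mulmxA hs' mul_scalar_mx => /eqP; rewrite scaler_eq0 emb_eq0 (negbTE s0).
  (* Conjugated by M, the dual formula compares s br X M with p (Mz)(Mz)^*; the direct one, times s,
     compares it with s m (Uz)(Uz)^*. *)
  apply: (oproj_line (b := s * m) n_gt2 p0 Mz0).
  exists (s * r2 - r1 * s).
  have e3 : M *m (br (ct X) (ct M) - emb p *: oproj z z) *m ct M = (emb (r1 * s))%:M.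
    by rewrite hr1 mul_mx_scalar -scalemxAl hs scale_scalar_mx rmorphM.
  rewrite mulmxBr mulmxBl e -scalemxAr -scalemxAl oproj_mull oproj_mulr ctK in e3.
  have -> : (emb (s * r2 - r1 * s))%:M = emb s *: (emb r2)%:M - (emb (r1 * s))%:M :> 'M[F]_n.
    by rewrite rmorphB raddfB /= scale_scalar_mx -rmorphM.
  rewrite -e3 -hr2 (rmorphM _ s m).
  move: (br X M) (oproj (M *m z) _) (oproj (U *m z) _) => Y1 Y2 Y3.
  by apply/matrixP => i j; rewrite !mxE; ring.
have [d hd] : exists d, ct U *m M = d%:M.
  apply: all_eigen_scalar => z; have [->|z0] := eqVneq z 0.
    by exists 0; rewrite mulmx0 scaler0.
  by have [d hd] := line _ z0; exists d; rewrite -mulmxA hd -scalemxAr mulmxA hU mul1mx.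
exists d; rewrite -[LHS]mul1mx -(unitaryC hU) -mulmxA hd mul_mx_scalar.
by [].
Qed.

(* T(zz^* ) is read off from 1 and 1 - 2zz^*, and also from their products with
   another reflection 1 - 2ww^*; the eigenvalues therefore agree. A rotation V
   fixing w is compared with V - 2ww^* to reach the skew-Hermitian matrices. *)
Lemma unitary_eigen_scalar T :
  (forall a A B, T (emb a *: A + B) = emb a *: T A + T B) ->
  (forall U, unitary U -> exists g, T U = g *: U) ->
  exists g, forall A, T A = g *: A.
Proof.
move=> T_lin hT; have [g hg] := hT _ (unitary1 n).
have TD := rlinD T_lin; have TB := rlinB T_lin; have TZ := rlinZ T_lin.
exists g.
have two : 2%:R != 0 :> F by exact: (nat_neq0 1).
have dbl (c : F) (v : 'cV[F]_n) : v != 0 -> c *: v = - (c *: v) -> c = 0.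
  move=> v0 /eqP; rewrite -subr_eq0 opprK -scalerDl scaler_eq0 (negbTE v0) orbF -mulr2n.
  by rewrite -mulr_natr mulf_eq0 (negbTE two) orbF => /eqP.
have canc (a b : F) (v : 'cV[F]_n) : v != 0 -> a *: v = b *: v -> a = b.
  by move=> v0 /eqP; rewrite -subr_eq0 -scalerBl scaler_eq0 (negbTE v0) orbF subr_eq0 => /eqP.
have refl_eq z : nq z = 1 -> T (oproj z z) = g *: oproj z z.
  move=> z1; have z0 : z != 0 by rewrite -nq_eq0 z1 oner_eq0.
  have [w0 w00 [zw0 _]] := orth_pair z z n_gt2.
  have [a a0 w1] := unit_scale w00; set w := _ *: w0 in w1.
  have zw : dot z w = 0 by rewrite dotZr zw0 mulr0.
  have wz : dot w z = 0 by rewrite dotC zw rmorph0.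
  have w0' : w != 0 by rewrite -nq_eq0 w1 oner_eq0.
  have [v v0 [zv wv]] := orth_pair z w n_gt2.
  have [g1 h1] := hT _ (unitary_refl z1).
  have [g2 h2'] := hT _ (unitary_refl w1).
  have [g3 h3] := hT _ (unitaryM (unitary_refl z1) (unitary_refl w1)).
  have e : (1%:M - oproj z z *+ 2) *m (1%:M - oproj w w *+ 2) =
      1%:M - oproj z z *+ 2 - oproj w w *+ 2.
    rewrite mulmxBl mul1mx mulmxBr mulmx1 !mulr2n mulmxDl mulmxDr.
    rewrite oproj_mull oprojE zw scale0r /oproj !mul0mx !addr0 subr0.
    by rewrite addrAC.
  rewrite e in h3.
  have TP2 : T (oproj z z) *+ 2 = g *: 1%:M - g1 *: (1%:M - oproj z z *+ 2).
    by rewrite -h1 -hg -TB subKr mulr2n TD -mulr2n.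
  have TP2' : T (oproj z z) *+ 2 = g2 *: (1%:M - oproj w w *+ 2) -
      g3 *: (1%:M - oproj z z *+ 2 - oproj w w *+ 2).
    rewrite -h2' -h3 -TB.
    have -> : 1%:M - oproj w w *+ 2 - (1%:M - oproj z z *+ 2 - oproj w w *+ 2) = oproj z z *+ 2.
      by apply/matrixP => i j; rewrite !mxE; ring.
    by rewrite mulr2n TD -mulr2n.
  have zz0 u : dot z u = 0 -> (oproj z z *+ 2) *m u = 0.
    by move=> zu; rewrite mulr2n mulmxDl oprojE zu scale0r addr0.
  have ww0 u : dot w u = 0 -> (oproj w w *+ 2) *m u = 0.
    by move=> zu; rewrite mulr2n mulmxDl oprojE zu scale0r addr0.
  have www : (oproj w w *+ 2) *m w = w + w.
    by rewrite mulr2n mulmxDl oprojE dotxx w1 rmorph1 scale1r.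
  (* The two expressions for 2 T(zz^* ) are compared at v, orthogonal to z and w, and at w, where
     the reflection flips the sign; so g - g1 equals its own negative. *)
  have a1 : g - g1 = g2 - g3.
    apply: (canc _ _ v v0); have := congr1 (fun M => M *m v) TP2'; rewrite TP2.
    by rewrite !mulmxBl -!scalemxAl !mulmxBl !mul1mx zz0 // ww0 // !subr0 !scalerBl.
  have a2 : g - g1 = - (g2 - g3).
    apply: (canc _ _ w w0'); have := congr1 (fun M => M *m w) TP2'; rewrite TP2.
    rewrite !mulmxBl -!scalemxAl !mulmxBl !mul1mx zz0 // www !subr0 !scalerBl => ->.
    by rewrite opprD addrA subrr sub0r !scalerN scaleNr scalerBl opprB opprK addrC.
  have gg1 : g - g1 = 0.
    by apply: (dbl _ v v0); rewrite -scaleNr; congr (_ *: _); rewrite {1}a1 a2 opprK.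
  move/eqP: gg1; rewrite subr_eq0 => /eqP gg1.
  rewrite -gg1 -scalerBr subKr in TP2.
  by rewrite -[LHS]half_scale -mulr2n TP2 mulr2n scalerA mulrC -scalerA half_scale.
have herm_eq H : ct H = H -> T H = g *: H.
  move: H; apply: (herm_ind (P := fun H => T H = g *: H)).
  - by move=> A B hA hB; rewrite TD hA hB scalerDr.
  - by move=> a A hA; rewrite TZ hA !scalerA mulrC.
  move=> z; have [->|z0] := eqVneq z 0.
    by rewrite /oproj mul0mx (rlin0 T_lin) scaler0.
  have [a a0 z1] := unit_scale z0; have := refl_eq _ z1.
  rewrite oprojZl oprojZr scalerA cj_emb -rmorphM TZ scalerA [g * _]mulrC -scalerA => h.
  by apply: (scalerI _ h); rewrite emb_eq0 mulf_neq0 // gt_eqF.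
have skew_eq K : ct K = - K -> T K = g *: K.
  move: K; apply: (skew_ind (P := fun K => T K = g *: K)).
  - by move=> A B hA hB; rewrite TD hA hB scalerDr.
  - by move=> a A hA; rewrite TZ hA !scalerA mulrC.
  - by rewrite (rlin0 T_lin) scaler0.
  move=> K Q hK [i [j hw]]; have [l /andP[li lj]] := third n_gt2 i j.
  have {hw} Kw := hw l li lj; set w := delta_mx l 0 in Kw.
  case: (hK) => cK cQ KK QK KQ.
  have Qw : Q *m w = 0 by rewrite -[Q]opprK -KK mulNmx -mulmxA Kw mulmx0 oppr0.
  have w1 : nq w = 1.
    apply: (emb_inj).
    by rewrite -dotxx /dot ct_delta mul_delta_mx mxE !eqxx rmorph1.
  have w0 : w != 0 by rewrite -nq_eq0 w1 oner_eq0.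
  (* Cosine 0 and sine 1 make V = 1 - Q + K, so K differs from V by a Hermitian matrix, where T is
     known. *)
  have cs : (0 : R) ^+ 2 + 1 ^+ 2 = 1 by ring.
  have hV := unitary_rot hK cs; set V := _ + _ in hV.
  have Vw : V *m w = w.
    by rewrite /V !mulmxDl -!scalemxAl Kw Qw mul1mx !scaler0 !addr0.
  have eK : K = V - (1%:M - Q).
    rewrite /V sub0r rmorphN1 scaleN1r rmorph1 scale1r.
    by apply/matrixP => p q; rewrite !mxE; ring.
  clearbody V; have [gV hgV] := hT _ hV.
  have [g' hg'] := hT _ (unitaryM hV (unitary_refl w1)).
  have e : V *m (1%:M - oproj w w *+ 2) = V - oproj w w *+ 2.
    by rewrite mulmxBr mulmx1 mulr2n mulmxDr oproj_mull Vw -mulr2n.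
  rewrite e TB hgV mulr2n TD refl_eq // -mulr2n in hg'.
  have [v v0 [wv _]] := orth_pair w w n_gt2.
  have Vv0 : V *m v != 0 by rewrite -nq_eq0 unitary_nq // nq_eq0.
  have gg' : gV = g'.
    apply: (canc _ _ _ Vv0); have := congr1 (fun M => M *m v) hg'.
    rewrite !mulr2n -!scalerDr !mulmxBl -!scalemxAl mulmxBl mulmxDl !oprojE wv.
    by rewrite scale0r !addr0 scaler0 !subr0.
  have ggV : gV = g.
    have := congr1 (fun M => M *m w) hg'; rewrite -gg'.
    rewrite !mulr2n -!scalerDr !mulmxBl -!scalemxAl mulmxBl mulmxDl !oprojE dotxx w1.
    rewrite Vw rmorph1 scale1r scalerBr => /addrI/oppr_inj/esym.
    apply: canc.
    by rewrite -mulr2n -scaler_nat scaler_eq0 negb_or two.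
  rewrite eK.
  rewrite TB hgV ggV [T (_ - Q)]herm_eq ?scalerBr //.
  by rewrite ctB ct1 cQ.
move=> A; have eA : A = emb 2^-1 *: (A + ct A) + emb 2^-1 *: (A - ct A).
  by rewrite -scalerDr addrACA subrr addr0 half_scale.
rewrite {1}eA TD [X in X + _]herm_eq; last by rewrite ctZ cj_emb ctD ctK addrC.
rewrite [X in _ + X]skew_eq; last by rewrite ctZ cj_emb ctB ctK -scalerN opprB.
by rewrite -scalerDr -eA.
Qed.

(** The normalized map is the scalar g, so T is g times the inverse of the twist; as s is an
    involution, that inverse is the twist by s(U)^*. *)
Lemma preserver_form T : preserver T ->
  exists g V (s : {rmorphism F -> F}), [/\ g != 0, unitary V, conj_or_id s &
    forall A, T A = g *: twist V s A].
Proof.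
move=> hT; have [U [s [hU hs [x x0 hx]]]] := preserver_normalize hT.
have hT1 := preserver_twist hU hs hT; set T1 := fun A => _ in hx hT1.
have hM := source_fixed_dual hT1 x0 hx.
have hL y B : y != 0 -> isL B y -> isL (T1 B) y.
  by move=> y0; case: (hx _ y0) => _ _ _; apply.
case: (hT1) => -[T1_lin _ T1_inj] _.
have [g hg] : exists g, forall A, T1 A = g *: A.
  apply: unitary_eigen_scalar => // V hV.
  by apply: (fixed_unitary hT1 hL _ hV) => y A; apply: hM.
exists g, (ct (map_mx s U)), s; split=> //.
- apply/eqP => g0; have := T1_inj 1%:M; rewrite hg g0 scale0r => /(_ erefl)/matrixP.
  by move=> /(_ (Ordinal n_gt0) (Ordinal n_gt0))/eqP; rewrite !mxE eqxx oner_eq0.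
- by apply: unitary_ct; apply: coi_unitary.
move=> A; have := hg (map_mx s (ct U *m A *m U)).
by rewrite /T1 twist_inv // /twist ctK !map_mxM (coi_ct hs).
Qed.

Lemma form_preserves g V (s : {rmorphism F -> F}) T : g != 0 -> unitary V ->
  conj_or_id s -> (forall A, T A = g *: twist V s A) ->
  forall A B, N2 (A *m B) = N2 A * N2 B -> N2 (T A *m T B) = N2 (T A) * N2 (T B).
Proof.
move=> g0 hV hs hT A B e.
have NZ (c : F) (M : 'M[F]_n) : N2 (c *: M) = nrm2 c * N2 M.
  have [y y0 hy] := isM_exists n_gt0 M.
  apply: (N2_unique n_gt0 y0) => [x|]; last first.
    by rewrite -scalemxAl nqZ (isM_N2 n_gt0 hy) mulrA.
  rewrite -!scalemxAl !nqZ -!mulrA; apply: ler_wpM2l; first exact: nrm2_ge0.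
  exact: hy.
rewrite !hT -scalemxAl -scalemxAr !NZ -twistM // !twist_N2 // e; ring.
Qed.

Theorem main_generic : main_stmt emb cj nrm2 n.
Proof.
move=> T T_lin [T' TK T'K]; split=> [hP|[g [V [g0 hV hT]]]].
  have hT : preserver T.
    split; first split=> //.
    - by move=> B; exists (T' B).
    - by move=> A h; rewrite -[A]TK h -[X in T' X](rlin0 T_lin) TK.
    by move=> A B /(N2_mul n_gt0) h; apply/(N2_mul n_gt0); apply: hP.
  have [g [V [s [g0 hV hs h]]]] := preserver_form hT.
  exists g, V; split=> //; case: hs => es; [left | right] => A; rewrite h /twist.
    by congr (_ *: (_ *m _ *m _)); apply/matrixP => i j; rewrite mxE es.
  by congr (_ *: (_ *m _ *m _)); apply/matrixP => i j; rewrite !mxE es.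
move=> A B /(N2_mul n_gt0) e; apply/(N2_mul n_gt0); move: A B e.
case: hT => hT.
  apply: (@form_preserves g V idfun T g0 hV) => [|A]; first by left.
  by rewrite hT /twist map_mx_id.
by apply: (@form_preserves g V cj T g0 hV) => //; right.
Qed.

End Preservers.

End Scalars.

(* Finite dimension and compactness over the reals *)
From mathcomp Require Import topology normedtype derive.
Import numFieldNormedType.Exports.

Lemma surjective_linear_ker0 (K : fieldType) (vT : vectType K) (g : vT -> vT) :
  linear g -> (forall v, exists u, g u = v) -> forall u, g u = 0 -> u = 0.
Proof.
move=> g_lin g_surj u gu0.
pose gL : {linear vT -> vT} := HB.pack g (GRing.isLinear.Build K vT vT *:%R g g_lin).
pose f := linfun gL.
have fE v : f v = g v by rewrite lfunE.
have img : (limg f = fullv)%VS.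
  apply/eqP; rewrite eqEsubv subvf /=; apply/subvP => v _.
  by have [w <-] := g_surj v; rewrite -fE memv_img ?memvf.
have := limg_ker_dim f fullv; rewrite img capfv => /eqP.
rewrite -[X in _ == X]add0n eqn_add2r dimv_eq0 => /eqP k0.
have : u \in lker f by rewrite memv_ker fE gu0.
by rewrite k0 memv0 => /eqP.
Qed.

Section Attained.
Local Open Scope classical_set_scope.
Variable R : realType.

Lemma continuous_bigsum (T : topologicalType) (I : Type) (r : seq I) (f : I -> T -> R) :
  (forall i, continuous (f i)) -> continuous (fun x => \sum_(i <- r) f i x).
Proof.
move=> cf; elim: r => [|i r IH] x.
  by under eq_fun do rewrite big_nil; apply: cvg_cst.
by under eq_fun do rewrite big_cons; apply: cvgD; [apply: cf | apply: IH].
Qed.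

(** Extreme value theorem on the unit sphere, a closed subset of the cube [-1, 1]^n; vectors are
    transposed to rows to match [rV_compact] and [EVT_max_rV]. *)
Lemma real_attained p n (A : 'M[R]_(p, n)) : (0 < n)%N ->
  exists2 x : 'cV[R]_n, \sum_i x i 0 ^+ 2 = 1 &
    forall y : 'cV[R]_n, \sum_i y i 0 ^+ 2 = 1 ->
      \sum_i (A *m y) i 0 ^+ 2 <= \sum_i (A *m x) i 0 ^+ 2.
Proof.
move=> n0; pose q (v : 'rV[R]_n) := \sum_i v 0 i ^+ 2.
pose f (v : 'rV[R]_n) := \sum_i (\sum_j A i j * v 0 j) ^+ 2.
have csqr (g : 'rV[R]_n -> R) : continuous g -> continuous (fun v => g v ^+ 2).
  move=> cg; have -> : (fun v => g v ^+ 2) = (fun v => g v * g v).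
    by apply/funext => v; rewrite expr2.
  by move=> v; apply: continuousM; exact: cg.
have cq : continuous q.
  by apply: continuous_bigsum => i; apply: csqr; apply: coord_continuous.
have cf : continuous f.
  apply: continuous_bigsum => i; apply: csqr; apply: continuous_bigsum => j v.
  apply: (@continuousM _ _ (fun=> A i j) (fun v : 'rV[R]_n => v 0 j)).
    exact: cst_continuous.
  exact: coord_continuous.
pose Sph : set 'rV[R]_n := [set v | q v = 1].
have cS : compact Sph.
  have cbox : compact [set v : 'rV[R]_n | forall i, `[(-1 : R), 1]%classic (v ord0 i)].
    by apply: (@rV_compact _ _ (fun=> `[(-1 : R), 1]%classic)) => _; apply: segment_compact.
  apply: (subclosed_compact _ cbox).
    apply: (closed_comp (f := q) (D := [set x | x = 1])) => [v _|].
      exact: cq.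
    exact: closed_eq.
  move=> v qv i; rewrite /= in_itv /= -ler_norml -(@expr_le1 _ 2) // real_normK ?num_real //.
  rewrite -qv /q (bigD1 i) //= lerDl; apply: sumr_ge0 => j _; exact: sqr_ge0.
have S0 : Sph !=set0.
  exists (delta_mx 0 (Ordinal n0)); rewrite /Sph /= /q (bigD1 (Ordinal n0)) //= big1.
    by rewrite mxE !eqxx expr1n addr0.
  by move=> j j0; rewrite mxE (negbTE j0) andbF expr0n.
have [c cin cmax] := EVT_max_rV S0 cS (continuous_subspaceT cf).
have fE (v : 'cV[R]_n) : \sum_i (A *m v) i 0 ^+ 2 = f v^T.
  apply: eq_bigr => i _; rewrite mxE; congr (_ ^+ 2).
  by apply: eq_bigr => j _; rewrite mxE.
have qE (v : 'cV[R]_n) : \sum_i v i 0 ^+ 2 = q v^T.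
  by apply: eq_bigr => i _; rewrite mxE.
exists c^T; first by rewrite qE trmxK; move: cin; rewrite inE.
by move=> y hy; rewrite !fE trmxK; apply: cmax; rewrite inE /Sph /= -qE.
Qed.
End Attained.

(** * The real and the complex instance *)

Section Instances.
Variable R : realType.

Lemma real_fin_dim m p (g : 'M[R]_(m, p) -> 'M[R]_(m, p)) :
  (forall a A B, g (a *: A + B) = a *: g A + g B) ->
  (forall B, exists A, g A = B) -> forall A, g A = 0 -> A = 0.
Proof. exact: surjective_linear_ker0. Qed.

(** Transparent, as is [complex_scalars], so that the projections unfold to the data of the stated
    theorem. *)
Definition real_scalars : scalars R R.
Proof.
apply: (@Scalars R R idfun idfun id (fun a => a ^+ 2)) => //=.
- exact: sqr_ge0.
- exact: real_fin_dim.
- by move=> n A; apply: real_attained.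
by left.
Defined.

Local Notation C := R[i].
Let cx m p (P : 'M[R]_(m, p) * 'M[R]_(m, p)) : 'M[C]_(m, p) :=
  \matrix_(i, j) (P.1 i j +i* P.2 i j)%C.
Let re2 m p (A : 'M[C]_(m, p)) : 'M[R]_(m, p) * 'M[R]_(m, p) :=
  (map_mx (@complex.Re R) A, map_mx (@complex.Im R) A).

(** As g is only real-linear, complex matrices are viewed as pairs of real ones. *)
Lemma complex_fin_dim m p (g : 'M[C]_(m, p) -> 'M[C]_(m, p)) :
  (forall a A B, g ((a%:C)%C *: A + B) = (a%:C)%C *: g A + g B) ->
  (forall B, exists A, g A = B) -> forall A, g A = 0 -> A = 0.
Proof.
have cxK : cancel (@cx m p) (@re2 m p).
  by move=> [P Q]; congr (_, _); apply/matrixP => i j; rewrite !mxE.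
have re2K : cancel (@re2 m p) (@cx m p).
  by move=> A; apply/matrixP => i j; rewrite !mxE /=; case: (A i j).
have cx_lin a P Q : cx (a *: P + Q) = (a%:C)%C *: cx P + cx Q.
  by apply/matrixP => i j; rewrite !mxE /=; simpc.
have re_lin a A B : re2 ((a%:C)%C *: A + B) = a *: re2 A + re2 B.
  apply: injective_projections; apply/matrixP => i j; rewrite !mxE;
    by case: (A i j) (B i j) => x y [z t] /=; ring.
move=> g_lin g_surj A gA.
have h : linear (fun P => re2 (g (cx P))) by move=> a P Q; rewrite cx_lin g_lin re_lin.
have := @surjective_linear_ker0 _ _ _ h _ (re2 A); rewrite re2K gA => h0.
rewrite -[A]re2K h0.
- by apply/matrixP => i j; rewrite !mxE.
- by move=> P; have [B hB] := g_surj (cx P); exists (re2 B); rewrite re2K hB cxK.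
by congr (_, _); apply/matrixP => i j; rewrite !mxE.
Qed.

Lemma complex_attained n (A : 'M[C]_n) : (0 < n)%N ->
  exists2 x : 'cV[C]_n,
    \sum_i (complex.Re (x i 0) ^+ 2 + complex.Im (x i 0) ^+ 2) = 1 &
    forall y : 'cV[C]_n, \sum_i (complex.Re (y i 0) ^+ 2 + complex.Im (y i 0) ^+ 2) = 1 ->
      \sum_i (complex.Re ((A *m y) i 0) ^+ 2 + complex.Im ((A *m y) i 0) ^+ 2)
      <= \sum_i (complex.Re ((A *m x) i 0) ^+ 2 + complex.Im ((A *m x) i 0) ^+ 2).
Proof.
move=> n0; pose X := map_mx (@complex.Re R) A; pose Y := map_mx (@complex.Im R) A.
pose dec (v : 'cV[R]_(n + n)) : 'cV[C]_n := cx (usubmx v, dsubmx v).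
pose enc (x : 'cV[C]_n) : 'cV[R]_(n + n) := col_mx (re2 x).1 (re2 x).2.
have encK x : dec (enc x) = x.
  by rewrite /dec /enc col_mxKu col_mxKd; apply/matrixP => i j; rewrite !mxE /=; case: (x i j).
have decK v : enc (dec v) = v.
  rewrite /enc -[RHS]vsubmxK.
  by congr col_mx; apply/matrixP => i j; rewrite !mxE /= ?mxE.
have qE (x : 'cV[C]_n) :
    \sum_i (complex.Re (x i 0) ^+ 2 + complex.Im (x i 0) ^+ 2) = \sum_i enc x i 0 ^+ 2.
  rewrite big_split_ord /= big_split; congr (_ + _); apply: eq_bigr => i _.
    by rewrite col_mxEu mxE.
  by rewrite col_mxEd mxE.
(* The real matrix of X + iY acting on pairs of real and imaginary parts. *)
pose B := block_mx X (- Y) Y X.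
have BE x : enc (A *m x) = B *m enc x.
  rewrite /enc mul_block_col; congr col_mx; apply/matrixP => i j; rewrite !mxE.
    rewrite raddf_sum -big_split; apply: eq_bigr => l _; rewrite !mxE.
    by case: (A i l) (x l j) => a b [c d] /=; ring.
  rewrite raddf_sum -big_split; apply: eq_bigr => l _; rewrite !mxE.
  by case: (A i l) (x l j) => a b [c d] /=; ring.
have [v v1 hv] := real_attained B (ltn_addr n n0).
exists (dec v); first by rewrite qE decK.
by move=> y; rewrite !qE !BE decK; apply: hv.
Qed.

Definition complex_scalars : scalars R C.
Proof.
apply: (@Scalars R C (@real_complex R) (@conjc R) (@complex.Re R)
  (fun z => complex.Re z ^+ 2 + complex.Im z ^+ 2)) => /=.
- exact: conjcK.
- exact: conjc_real.
- by move=> [a b]; simpc; rewrite mulr2n.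
- by move=> [a b]; apply/eqP; rewrite eq_complex /=; apply/andP; split; apply/eqP; ring.
- by move=> z; rewrite addr_ge0 ?sqr_ge0.
- exact: complex_fin_dim.
- exact: complex_attained.
right; exists ('i)%C; split.
- by simpc.
- by simpc.
move=> [a b]; exists a, b; by simpc.
Defined.

End Instances.

Theorem mainTheorem3 (R : realType) (n : nat) : (3 <= n)%N ->
  main_stmt_real R n /\ main_stmt_complex R n.
Proof.
move=> n3; split.
  exact (@main_generic R R (real_scalars R) n n3).
exact (@main_generic R _ (complex_scalars R) n n3).
Qed.
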